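(* Suppose that for all $i\in\{1,\dots,n-1\}$, $X_i$ admits a density $\varphi_i$ with respect to some known measure $\nu$ such that $\nu(A_1)=1$, and that there exists $\kappa$ such that $\varphi_i(x)\le\kappa$ for all $x\in A_1$ and $i\in\{1,\dots,n-1\}$. Let $\mathbb{V}$ be an at most countable collection of models, and let $(\Delta(V))_{V\in\mathbb{V}}$ be a family of non-negative numbers such that $$\sum_{V\in\mathbb{V}}e^{-\Delta(V)}\le1.$$ Then there exists an estimator $\hat s$ such that $$C\,\mathbb{E}\left[H^2(s\mathbf{1}_A,\hat s)\right]\le\inf_{V\in\mathbb{V}}\left\{d^2\left(\sqrt{s}|_A,V\right)+\frac{\Delta(V)+\dim(V)\log n}{n}\right\},$$ where $C>0$ depends only on $\kappa$.
   Context: Let $n>3$. $(X_i)_{i\ge0}$ is a time-homogeneous Markov chain with values in a measured space $(\mathbb{X},\mathcal{F},\mu)$ such that for each $x\in\mathbb{X}$ the conditional law of $X_{i+1}$ given $X_i=x$ has a density $s(x,\cdot)$ with respect to $\mu$ ($s$ is the unknown transition density). $A=A_1\times A_2$ is a subset of $\mathbb{X}^2$; an estimator is a (non-negative) function built from the observations $X_0,\dots,X_n$ only. $\sqrt s|_A$ is the restriction of $\sqrt s$ to $A$. For non-negative functions $f,f'$ on $\mathbb{X}^2$ integrable with respect to $M=\lambda_n\otimes\mu$, $\lambda_n=n^{-1}\sum_{i=0}^{n-1}\delta_{X_i}$, $$H^2(f,f')=\frac1{2n}\sum_{i=0}^{n-1}\int_{\mathbb{X}}\left(\sqrt{f(X_i,y)}-\sqrt{f'(X_i,y)}\right)^2d\mu(y).$$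 $\mathbb{L}^2(A,\nu\otimes\mu)$ is endowed with its distance $d^2(f,f')=\int_A(f(x,y)-f'(x,y))^2\,d\nu(x)\,d\mu(y)$, and $d(f,V)=\inf_{g\in V}d(f,g)$. A model $V$ is a non-trivial finite-dimensional linear subspace of $\mathbb{L}^2(A,\nu\otimes\mu)$. *)

(* Defs.v *)
From mathcomp Require Import all_boot all_order all_algebra.
From mathcomp Require Import all_classical all_reals all_analysis.

Set Implicit Arguments.
Unset Strict Implicit.
Unset Printing Implicit Defensive.

Import Order.TTheory GRing.Theory Num.Theory.
Import numFieldNormedType.Exports.

Local Open Scope classical_set_scope.
Local Open Scope ring_scope.

(* The conditional law of X_{i+1} given X_i = x is s (x, .) mu, for every x. *)
Definition transition_density (R : realType) (dT : measure_display)
    (T : measurableType dT) (mu : {measure set T -> \bar R})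
    (s : T * T -> R) : Prop :=
  [/\ measurable_fun setT s,
      (forall z, 0 <= s z) &
      (forall x, (\int[mu]_y (s (x, y))%:E = 1)%E)].

(* The sigma-algebra generated by X_0, ..., X_i. *)
Definition past (dO dT : measure_display) (Omega : measurableType dO)
    (T : measurableType dT) (X : nat -> Omega -> T) (i : nat) :
    set (set Omega) :=
  <<s [set E | exists j : nat, (j <= i)%N /\
                 exists B : set T, measurable B /\ E = X j @^-1` B] >>.

(* The last condition says that \int_B s (X_i, y) dmu(y) is a version of
   P (X_{i+1} \in B | X_0, ..., X_i): the Markov property and homogeneity,
   together with the transition density. *)
Definition markov_chain (R : realType) (dO dT : measure_display)
    (Omega : measurableType dO) (T : measurableType dT)
    (P : probability Omega R) (mu : {measure set T -> \bar R})
    (s : T * T -> R) (X : nat -> Omega -> T) : Prop :=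
  [/\ transition_density mu s,
      (forall i, measurable_fun setT (X i)) &
      (forall (i : nat) (E : set Omega) (B : set T),
         past X i E -> measurable B ->
         P (E `&` X i.+1 @^-1` B) =
           (\int[P]_(w in E) \int[mu]_(y in B) (s (X i w, y))%:E)%E)].

Definition has_density (R : realType) (dO dT : measure_display)
    (Omega : measurableType dO) (T : measurableType dT)
    (P : probability Omega R) (nu : {measure set T -> \bar R})
    (Y : Omega -> T) (phi : T -> R) : Prop :=
  [/\ measurable_fun setT phi,
      (forall x, 0 <= phi x) &
      (forall B : set T, measurable B ->
         P (Y @^-1` B) = (\int[nu]_(x in B) (phi x)%:E)%E)].

(* The loss H^2, at the observed trajectory x_0, x_1, ... *)
Definition hellinger2 (R : realType) (dT : measure_display)
    (T : measurableType dT) (mu : {measure set T -> \bar R}) (n : nat)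
    (x : nat -> T) (f g : T * T -> R) : \bar R :=
  (((2 * n%:R)^-1)%:E *
    \sum_(i < n)
      \int[mu]_y ((Num.sqrt (f (x i, y)) - Num.sqrt (g (x i, y))) ^+ 2)%:E)%E.

(* An estimator is a function of the observations (x_0, ..., x_n) alone.  Joint
   measurability makes the risk meaningful, and the last condition is the
   integrability of the estimator with respect to lambda_n \x mu, where
   lambda_n is the empirical measure of x_0, ..., x_{n-1}. *)
Definition is_estimator (R : realType) (dT : measure_display)
    (T : measurableType dT) (mu : {measure set T -> \bar R}) (n : nat)
    (shat : n.+1.-tuple T -> T * T -> R) : Prop :=
  [/\ measurable_fun setT
        (fun w : n.+1.-tuple T * (T * T) => shat w.1 w.2),
      (forall x z, 0 <= shat x z) &
      (forall (x : n.+1.-tuple T) (i : 'I_n),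
         (\int[mu]_y (shat x (tnth x (widen_ord (leqnSn n) i), y))%:E
            < +oo)%E)].

(* L^2(A, m), as the L^2 space of the restriction of m to A; its elements are
   classes of functions, coerced to functions through a representative. *)
Notation L2 m mA := (LspaceType2 (mrestr m mA)).

(* e is a basis of the linear subspace V of L^2(m); linear combinations are
   formed on representatives and compared up to m-negligible sets. *)
Definition is_basis (R : realType) (d : measure_display)
    (Z : measurableType d) (m : {measure set Z -> \bar R})
    (V : set (LspaceType2 m)) (D : nat) (e : 'I_D -> LspaceType2 m) : Prop :=
  (forall c : 'I_D -> R,
     {ae m, forall z, \sum_(k < D) c k * (e k : Z -> R) z = 0} ->
     forall k, c k = 0) /\
  V = [set g : LspaceType2 m | exists c : 'I_D -> R,
         {ae m, forall z, (g : Z -> R) z =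
                          \sum_(k < D) c k * (e k : Z -> R) z}].

Definition has_dim (R : realType) (d : measure_display)
    (Z : measurableType d) (m : {measure set Z -> \bar R})
    (V : set (LspaceType2 m)) (D : nat) : Prop :=
  exists e : 'I_D -> LspaceType2 m, is_basis V e.

Definition is_model (R : realType) (d : measure_display)
    (Z : measurableType d) (m : {measure set Z -> \bar R})
    (V : set (LspaceType2 m)) : Prop :=
  exists D : nat, (0 < D)%N /\ has_dim V D.

(* Meaningful on finite-dimensional subspaces. *)
Definition model_dim (R : realType) (d : measure_display)
    (Z : measurableType d) (m : {measure set Z -> \bar R})
    (V : set (LspaceType2 m)) : nat :=
  xget 0%N [set D | has_dim V D].

Definition L2dist (R : realType) (d : measure_display)
    (Z : measurableType d) (m : {measure set Z -> \bar R}) (A : set Z)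
    (f g : Z -> R) : \bar R :=
  sqrte (\int[m]_(z in A) ((f z - g z) ^+ 2)%:E)%E.

Definition L2dist_to (R : realType) (d : measure_display)
    (Z : measurableType d) (m : {measure set Z -> \bar R}) (A : set Z)
    (mA : measurable A) (f : Z -> R) (V : set (L2 m mA)) : \bar R :=
  ereal_inf [set L2dist m A f (g : Z -> R) | g in V].

(* Main.v *)
(* Discretize every model: Gram-Schmidt in L^2 turns the ball of radius 2 of a
   D-dimensional model into a grid of (4n + 1)^D functions, of mesh
   D^(1/2) / n; only the finitely many models with Delta(V) <= n matter, since
   the loss is bounded.  Select one of these candidates by pairwise robust
   tests.  For candidates a = sqrt f and b = sqrt f', and t = sqrt (s 1_A), the
   score psi = 2 (b - a) / (a + b) satisfies |psi| <= 2 and, pointwise,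
     psi t^2 + (a^2 - b^2) / 2 <= (5 / 2) (a - t)^2 - (b - t)^2 / 4,
     psi^2 t^2 <= 8 ((a - t)^2 + (b - t)^2).
   Hence, conditionally on X_i = x, the exponential of 1/128 times
     psi(x, X_{i+1}) + (|a|^2 - |b|^2) / 2 - 3 |t - a|^2 + |t - b|^2 / 8,
   with norms in L^2(mu) on the section at x, has mean at most 1, and so has, by
   the Markov property, the product of these exponentials along the trajectory.
   This compares all candidates b with a fixed one a up to the penalty
   128 Delta, and a minimizer of the worst penalized test inherits the loss of
   a, up to constants.  The bound kappa on the densities then turns the random
   loss of the best grid point into the distance in L^2(nu \x mu); the log n is
   the log-cardinality of the grid, and it also pays for X_0, which has no
   density. *)
From HB Require Import structures.
From mathcomp Require Import finmap.
Require Import Defs.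
From mathcomp Require Import all_boot all_order all_algebra.
From mathcomp Require Import all_classical all_reals all_analysis.
From mathcomp Require Import measurable_realfun ring lra zify.

Set Implicit Arguments.
Unset Strict Implicit.
Unset Printing Implicit Defensive.

Import Order.TTheory GRing.Theory Num.Theory.
Import numFieldNormedType.Exports.

Local Open Scope classical_set_scope.
Local Open Scope ring_scope.

(** * Robust scores *)

(** From exp (- z) >= 1 - z one gets exp z <= 1 / (1 - z), and (1 - z) (1 + z + 2 z^2) = 1 + z^2 (1
    - 2 z) is at least 1 when z <= 1 / 2. *)
Lemma expR_le_quadratic (R : realType) (z : R) :
  z <= 1 / 2 -> expR z <= 1 + z + 2 * z ^+ 2.
Proof.
move=> zle; have z1 : 0 < 1 - z by lra.
have h : (expR z)^-1 >= 1 - z by rewrite -expRN; exact: expR_ge1Dx.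
have : expR z <= (1 - z)^-1.
  by rewrite -[expR z]invrK lef_pV2// posrE invr_gt0 expR_gt0.
move=> /le_trans; apply; rewrite -[leLHS]mul1r ler_pdivrMr//; nra.
Qed.

(** The first-order term of log (b / a) = 2 artanh ((b - a) / (a + b)); unlike the logarithm it is
    bounded. At a = b = 0 it takes the value 0, so that [scoreM] holds there too. *)
Definition score (R : realType) (a b : R) : R := 2 * (b - a) / (a + b).

Lemma scoreM (R : realType) (a b : R) : 0 <= a -> 0 <= b ->
  score a b * (a + b) = 2 * (b - a).
Proof.
move=> a0 b0; have [ab0|ab0] := eqVneq (a + b) 0; last by rewrite divfK.
by rewrite ab0 mulr0; lra.
Qed.

Lemma norm_score (R : realType) (a b : R) : 0 <= a -> 0 <= b ->
  `|score a b| <= 2.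
Proof.
move=> a0 b0; have [ab0|ab0] := eqVneq (a + b) 0.
  by rewrite /score ab0 invr0 mulr0 normr0.
have ab : 0 < a + b by rewrite lt_def ab0 addr_ge0.
by rewrite ler_norml /score ler_pdivrMr// ler_pdivlMr//; apply/andP; split; lra.
Qed.

Lemma scoreN (R : realType) (a b : R) : score a b = - score b a.
Proof. by rewrite /score (addrC b) -mulNr; congr (_ / _); ring. Qed.

(* With r = (a + b) / 2 one has (b - a) (r + t^2 / r) = 2 t (b - a)
   + (b - a) (r - t)^2 / r, and |b - a| <= 2 r. *)
Lemma score_drift (R : realType) (a b t : R) : 0 <= a -> 0 <= b -> 0 <= t ->
  score a b * t ^+ 2 + (a ^+ 2 - b ^+ 2) / 2
    <= 5 / 2 * (a - t) ^+ 2 - (b - t) ^+ 2 / 4.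
Proof.
move=> a0 b0 t0; have := scoreM a0 b0; have := norm_score a0 b0.
set q := score a b; rewrite ler_norml => /andP[_ q2] qE.
have qr : q * ((a + b) / 2) = b - a by lra.
have qt : q * t ^+ 2 =
    q * ((a + b) / 2 - t) ^+ 2 - (b ^+ 2 - a ^+ 2) / 2 + 2 * (b - a) * t.
  have -> : q * ((a + b) / 2 - t) ^+ 2 = q * ((a + b) / 2) * ((a + b) / 2)
     - 2 * (q * ((a + b) / 2)) * t + q * t ^+ 2 by ring.
  by rewrite qr; field.
have : q * ((a + b) / 2 - t) ^+ 2 <= 2 * ((a + b) / 2 - t) ^+ 2.
  by rewrite ler_wpM2r// sqr_ge0.
rewrite qt => H.
(* With u = a - t and v = b - t, what remains is 3 u^2 / 2 + u v - v^2 / 2 <= 5 u^2 / 2 - v^2 / 4;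
   the gap is (2 u - v)^2 / 4. *)
have := sqr_ge0 (a - t + (a - b)).
nra.
Qed.

(** If t <= a + b, the left side is at most q^2 (a + b)^2 = 4 (b - a)^2. Otherwise t < 2 t - a - b,
    and q^2 t^2 <= 4 t^2 <= 4 ((t - a) + (t - b))^2. *)
Lemma score_variance (R : realType) (a b t : R) : 0 <= a -> 0 <= b -> 0 <= t ->
  score a b ^+ 2 * t ^+ 2 <= 8 * ((a - t) ^+ 2 + (b - t) ^+ 2).
Proof.
move=> a0 b0 t0; have := scoreM a0 b0; have := norm_score a0 b0.
set q := score a b => q2 qE.
have q4 : q ^+ 2 <= 4.
  by rewrite -real_normK ?num_real//; have := normr_ge0 q; nra.
have [tp|pt] := leP t (a + b).
  have : q ^+ 2 * t ^+ 2 <= q ^+ 2 * (a + b) ^+ 2.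
    by rewrite ler_wpM2l ?sqr_ge0// lerXn2r// nnegrE addr_ge0.
  rewrite -[X in _ <= X -> _]exprMn qE => /le_trans; apply.
  have := sqr_ge0 ((a - t) + (b - t)); nra.
have : q ^+ 2 * t ^+ 2 <= 4 * t ^+ 2 by rewrite ler_wpM2r// sqr_ge0.
move=> /le_trans; apply.
have := sqr_ge0 ((a - t) - (b - t)).
nra.
Qed.

(** The factor 128 makes the quadratic term small: by [score_variance] it is at most ((a - t)^2 + (b
    - t)^2) / 8 over 128. This raises 5 / 2 to at most 3 and leaves half of the - (b - t)^2 / 4 of
    [score_drift]. *)
Lemma exp_score (R : realType) (a b t : R) : 0 <= a -> 0 <= b -> 0 <= t ->
  expR (score a b / 128) * t ^+ 2 <=
  t ^+ 2 + ((b ^+ 2 - a ^+ 2) / 2 + 3 * (a - t) ^+ 2 - (b - t) ^+ 2 / 8) / 128.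
Proof.
move=> a0 b0 t0; have := norm_score a0 b0; rewrite ler_norml => /andP[_ q2].
have := score_drift a0 b0 t0; have := score_variance a0 b0 t0.
set q := score a b in q2 *.
have qle : q / 128 <= 1 / 2 by lra.
have : expR (q / 128) * t ^+ 2 <= (1 + q / 128 + 2 * (q / 128) ^+ 2) * t ^+ 2.
  by rewrite ler_wpM2r ?sqr_ge0// expR_le_quadratic.
move=> H1 H2 H3; apply: (le_trans H1).
have -> : (1 + q / 128 + 2 * (q / 128) ^+ 2) * t ^+ 2 =
  t ^+ 2 + (q * t ^+ 2) / 128 + 2 / (128 * 128) * (q ^+ 2 * t ^+ 2) by field.
have := sqr_ge0 (a - t); lra.
Qed.

(** * Gram-Schmidt for semi-definite forms *)

Section gram_schmidt.
Context (R : realType) (V : lmodType R) (B : V -> V -> R).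
Hypothesis BC : forall u v, B u v = B v u.
Hypothesis BP : forall a u v w, B (a *: u + v) w = a * B u w + B v w.
Hypothesis B_ge0 : forall u, 0 <= B u u.

Let B0l w : B 0 w = 0.
Proof. by have := BP 1 0 0 w; rewrite scale1r addr0 mul1r; lra. Qed.

Let BDl u v w : B (u + v) w = B u w + B v w.
Proof. by rewrite -[u]scale1r BP mul1r scale1r. Qed.

Let BZl a u w : B (a *: u) w = a * B u w.
Proof. by rewrite -[a *: u]addr0 BP B0l addr0. Qed.

Let BNl u w : B (- u) w = - B u w.
Proof. by rewrite -scaleN1r BZl mulN1r. Qed.

Let BDr u v w : B w (u + v) = B w u + B w v.
Proof. by rewrite !(BC w) BDl. Qed.

Let BZr a u w : B w (a *: u) = a * B w u.
Proof. by rewrite !(BC w) BZl. Qed.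

Let B_suml (I : Type) (r : seq I) (F : I -> V) w :
  B (\sum_(i <- r) F i) w = \sum_(i <- r) B (F i) w.
Proof.
by apply: (big_morph (B ^~ w)) => [u v|]; [exact: BDl|exact: B0l].
Qed.

Let B_sumr (I : Type) (r : seq I) (F : I -> V) w :
  B w (\sum_(i <- r) F i) = \sum_(i <- r) B w (F i).
Proof. by rewrite BC B_suml; apply: eq_bigr => i _; exact: BC. Qed.

(** Otherwise t |-> B (u + t v) (u + t v) would be affine and non-constant, hence negative
    somewhere; the [t] below gives it the value - 1. *)
Lemma isotropic_orthogonal u v : B v v = 0 -> B u v = 0.
Proof.
move=> v0; apply/eqP; rewrite -normr_le0; apply/negPn/negP; rewrite -ltNge => h.
have uv0 : B u v != 0 by rewrite -normr_gt0.
pose t := - (B u u + 1) / (2 * B u v).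
have := B_ge0 (u + t *: v).
rewrite !BDl !BDr !BZl !BZr v0 !mulr0 addr0 (BC v).
have -> : B u u + t * B u v + t * B u v = B u u + t * (2 * B u v) by ring.
by rewrite /t divfK ?mulf_neq0 ?pnatr_eq0//; lra.
Qed.

(** The form may be degenerate, since it will be applied to functions rather than to classes. Some
    [u i] may therefore be isotropic, and the [e k] are recovered only up to isotropic vectors. *)
Lemma gram_schmidt (D : nat) (e : nat -> V) : exists u : nat -> V,
  [/\ forall i j, (i < D)%N -> (j < D)%N -> i != j -> B (u i) (u j) = 0,
      forall i, (i < D)%N -> B (u i) (u i) = 0 \/ B (u i) (u i) = 1 &
      forall k, (k < D)%N -> exists c : nat -> R,
        let w := e k - \sum_(j < D) c j *: u j in B w w = 0].
Proof.
elim: D => [|D [u [uo u1 ue]]]; first by exists (fun=> 0); split.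
pose w := e D - \sum_(j < D) B (e D) (u j) *: u j.
have wo j : (j < D)%N -> B w (u j) = 0.
  move=> jD; rewrite BDl BNl B_suml (bigD1 (Ordinal jD))//= big1 => [|i ij].
    rewrite BZl addr0; have [h|->] := u1 _ jD; last by rewrite mulr1 subrr.
    by rewrite h mulr0 subr0 isotropic_orthogonal.
  by rewrite BZl uo ?mulr0//; apply: contra ij => /eqP ij; exact/eqP/val_inj.
(* An isotropic remainder is kept as it is; any other one is normalized. *)
pose l := if B w w == 0 then 1 else (Num.sqrt (B w w))^-1.
have l0 : l != 0.
  rewrite /l; case: ifPn => [_|w0]; first exact: oner_neq0.
  by rewrite invr_eq0 sqrtr_eq0 -ltNge lt_def w0 B_ge0.
have lw : B (l *: w) (l *: w) = 0 \/ B (l *: w) (l *: w) = 1.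
  rewrite BZl BZr /l; case: eqVneq => [->|w0]; first by left; rewrite !mulr0.
  right; rewrite mulrA -invfM -expr2 sqr_sqrtr ?B_ge0// mulVf//.
pose u' k := if (k < D)%N then u k else l *: w.
have u'E (c : nat -> R) : \sum_(j < D.+1) c j *: u' j =
    \sum_(j < D) c j *: u j + (c D * l) *: w.
  rewrite big_ord_recr/= /u' ltnn scalerA; congr (_ + _).
  by apply: eq_bigr => j _; rewrite ltn_ord.
exists u'; split.
- move=> i j; rewrite !ltnS /u'; case: ltnP => iD; case: ltnP => jD.
  + by move=> _ _; exact: uo.
  + by move=> _ _ _; rewrite BZr BC wo// mulr0.
  + by move=> _ _ _; rewrite BZl wo// mulr0.
  + by move=> iD' jD'; rewrite neq_ltn; lia.
- by move=> i _; rewrite /u'; case: ltnP => // /u1.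
- move=> k; rewrite ltnS leq_eqVlt => /predU1P[->|kD].
    pose c j := if (j < D)%N then B (e D) (u j) else l^-1.
    exists c; rewrite /= u'E /c ltnn mulVf// scale1r.
    under eq_bigr do rewrite ltn_ord.
    by rewrite opprD addrA -/w subrr B0l.
  have [c ce] := ue _ kD.
  pose c' j := if (j < D)%N then c j else 0.
  exists c'; rewrite /= u'E /c' ltnn mul0r scale0r addr0.
  by under eq_bigr do rewrite ltn_ord.
Qed.

(** In the system given by [gram_schmidt], a vector of norm at most 2 has coordinates in [-2, 2].
    Rounding each of them down to a multiple of 1 / n costs at most 1 / n^2 in squared norm per
    coordinate. *)
Lemma grid_net (D n : nat) (e : 'I_D -> V) : (0 < n)%N ->
  exists F : {ffun 'I_D -> 'I_(4 * n + 1)} -> V, forall c : 'I_D -> R,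
    let f := \sum_k c k *: e k in B f f <= 4 ->
    exists i, B (f - F i) (f - F i) <= D%:R / n%:R ^+ 2.
Proof.
move=> n0.
pose e' (k : nat) := if insub k is Some i then e i else 0.
have [u [uo u1 ue]] := gram_schmidt D e'.
have nR : 0 < n%:R :> R by rewrite ltr0n.
exists (fun q : {ffun 'I_D -> 'I_(4 * n + 1)} =>
  \sum_(k < D) ((q k)%:R / n%:R - 2) *: u k) => c f f4.
have /choice[d de] : forall k : 'I_D, exists d : nat -> R,
    let w := e k - \sum_(j < D) d j *: u j in B w w = 0.
  by move=> k; have := ue k (ltn_ord k); rewrite /e' valK.
(* Coordinates along isotropic vectors do not affect the form and are not bounded by it; setting
   them to 0 keeps every coordinate in [-2, 2]. *)
pose b (j : 'I_D) := if B (u j) (u j) == 0 then 0 else \sum_k c k * d k j.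
pose g := \sum_(j < D) b j *: u j.
have fg : B (f - g) (f - g) = 0.
  have isoD v w : B v v = 0 -> B w w = 0 -> B (v + w) (v + w) = 0.
    move=> v0 w0; rewrite !BDl !BDr v0 w0 (BC w).
    by rewrite (isotropic_orthogonal v w0) !addr0.
  have isoZ a v : B v v = 0 -> B (a *: v) (a *: v) = 0.
    by move=> v0; rewrite BZl BZr v0 !mulr0.
  have isoS (I : Type) (r : seq I) (F : I -> V) :
      (forall i, B (F i) (F i) = 0) ->
      B (\sum_(i <- r) F i) (\sum_(i <- r) F i) = 0.
    move=> F0; elim/big_ind : _ => [|v w|i _]; [exact: B0l|exact: isoD|exact: F0].
  have -> : f - g = \sum_k c k *: (e k - \sum_(j < D) d k j *: u j) +
      \sum_(j < D) (\sum_k c k * d k j - b j) *: u j.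
    pose h := \sum_(j < D) (\sum_k c k * d k j) *: u j.
    rewrite -(subrK h f) -addrA; congr (_ + _); last first.
      by rewrite -sumrB; apply: eq_bigr => j _; rewrite scalerBl.
    transitivity (f - \sum_k c k *: \sum_(j < D) d k j *: u j).
      congr (_ - _); rewrite /h; under eq_bigr do rewrite scaler_suml.
      rewrite exchange_big/=; apply: eq_bigr => k _; rewrite scaler_sumr.
      by apply: eq_bigr => j _; rewrite scalerA.
    by rewrite -sumrB; apply: eq_bigr => k _; rewrite scalerBr.
  apply: isoD; [apply: isoS => k|apply: isoS => j].
    by apply: isoZ; exact: de.
  rewrite /b; case: eqVneq => [h|_]; first exact: isoZ.
  by rewrite subrr scale0r B0l.
have B_orth (a : 'I_D -> R) : B (\sum_(j < D) a j *: u j) (\sum_(j < D) a j *: u j) =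
    \sum_(j < D) a j ^+ 2 * B (u j) (u j).
  rewrite B_suml; apply: eq_bigr => j _; rewrite B_sumr (bigD1 j)//= big1 => [|i ij].
    by rewrite BZl BZr addr0 mulrA expr2.
  by rewrite BZl BZr uo ?mulr0// eq_sym.
(* As f - g is isotropic, hence orthogonal to everything, f may be replaced by its expansion g. *)
have Bfg v : B (f + v) (f + v) = B (g + v) (g + v).
  have -> : f + v = (f - g) + (g + v) by rewrite addrA subrK.
  rewrite (BDl (f - g)) !(BDr (f - g)) fg (BC (f - g)).
  by rewrite isotropic_orthogonal// !add0r.
have b2 j : `|b j| <= 2.
  have : b j ^+ 2 <= 4.
    apply: le_trans f4; rewrite -[f]addr0 Bfg addr0 B_orth (bigD1 j)//=.
    rewrite -[leLHS]addr0 lerD//; last first.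
      by apply: sumr_ge0 => i _; rewrite mulr_ge0// sqr_ge0.
    have [h|->] := u1 _ (ltn_ord j); last by rewrite mulr1.
    by rewrite /b h eqxx expr0n mul0r.
  rewrite -real_normK ?num_real//; have := normr_ge0 (b j); nra.
(* n (b j + 2) lies in [0, 4 n], so its integer part has 4 n + 1 possible values. *)
have qlt j : (Num.truncn (n%:R * (b j + 2)) < 4 * n + 1)%N.
  have := b2 j; rewrite ler_norml => /andP[b2l b2r].
  rewrite addn1 ltnS truncn_le_nat -[(4 * n).+1]addn1 natrD natrM.
  by apply: (@le_lt_trans _ _ (4 * n%:R)); [nra|lra].
pose q : {ffun 'I_D -> 'I_(4 * n + 1)} := [ffun j => Ordinal (qlt j)].
exists q; rewrite Bfg /g -sumrB.
under eq_bigr do rewrite -scalerBl.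
rewrite B_orth.
have -> : D%:R / n%:R ^+ 2 = \sum_(j < D) n%:R ^- 2 :> R.
  by rewrite sumr_const card_ord -[RHS]mulr_natl.
apply: ler_sum => j _.
have := b2 j; rewrite ler_norml => /andP[b2l b2r].
have nb : 0 <= n%:R * (b j + 2) by rewrite mulr_ge0//; lra.
have /andP[q1 q2] := truncn_itv nb.
set m := Num.truncn _ in q1 q2.
rewrite ffunE/= -/m.
have -> : b j - (m%:R / n%:R - 2) = (n%:R * (b j + 2) - m%:R) / n%:R.
  by field; rewrite gt_eqF.
rewrite expr_div_n -mulrA -[leRHS]mul1r.
have h0 : 0 <= n%:R ^- 2 :> R by rewrite invr_ge0 exprn_ge0// ltW.
have h1 : (n%:R * (b j + 2) - m%:R) ^+ 2 <= 1.
  rewrite -[m.+1]addn1 natrD in q2; set y := n%:R * _ - _.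
  have y0 : 0 <= y by rewrite subr_ge0.
  have y1 : y <= 1 by rewrite /y; lra.
  nra.
apply: ler_pM => //; first exact: sqr_ge0.
  by rewrite mulr_ge0.
have [->|->] := u1 _ (ltn_ord j); first by rewrite mulr0.
by rewrite mulr1.
Qed.

End gram_schmidt.

(** * Densities and the Markov property *)

Section density.
Context d (T : measurableType d) (R : realType).
Variables (m : {measure set T -> \bar R}) (rho : T -> R).
Local Open Scope ereal_scope.

(* The hypotheses on rho are arguments so that the measure instance is found. *)
Definition mdensity (mrho : measurable_fun setT rho)
    (rho0 : forall x, (0 <= rho x)%R) (A : set T) : \bar R :=
  \int[m]_(x in A) (rho x)%:E.

Hypotheses (mrho : measurable_fun setT rho) (rho0 : forall x, (0 <= rho x)%R).
Local Notation nu := (mdensity mrho rho0).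

Let nu0 : nu set0 = 0. Proof. exact: integral_set0. Qed.

Let nu_ge0 A : 0 <= nu A.
Proof. by apply: integral_ge0 => x _; rewrite lee_fin. Qed.

Let nu_sigma_additive : semi_sigma_additive nu.
Proof.
apply: semi_sigma_additive_nng_induced; first exact/measurable_EFinP.
by move=> x; rewrite lee_fin.
Qed.

HB.instance Definition _ := isMeasure.Build _ _ _ nu
  nu0 nu_ge0 nu_sigma_additive.

Import HBNNSimple.

(** Monotone approximation by simple functions reduces this to indicators, where it is the
    definition of [mdensity]. *)
Lemma integral_mdensity (f : T -> \bar R) :
  measurable_fun setT f -> (forall x, 0 <= f x) ->
  \int[nu]_x f x = \int[m]_x (f x * (rho x)%:E).
Proof.
move=> mf f0; pose h := nnsfun_approx measurableT mf.
have mh n : measurable_fun setT (EFin \o h n) by exact/measurable_EFinP.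
have hf x : f x = limn (fun n => (h n x)%:E).
  by apply/esym/cvg_lim => //; exact: cvg_nnsfun_approx.
have -> : \int[nu]_x f x = limn (fun n => \int[nu]_x (h n x)%:E).
  rewrite -monotone_convergence//; first by apply: eq_integral => x _.
  - by move=> n x _; rewrite lee_fin.
  - by move=> x _ a b ab; rewrite lee_fin; exact/lefP/nd_nnsfun_approx.
have -> : \int[m]_x (f x * (rho x)%:E) =
    limn (fun n => \int[m]_x ((h n x)%:E * (rho x)%:E)).
  rewrite -monotone_convergence//.
  - apply: eq_integral => x _; apply/esym/cvg_lim => //.
    by apply: cvgeZr => //; exact: cvg_nnsfun_approx.
  - move=> n; apply: emeasurable_funM => //; exact/measurable_EFinP.
  - by move=> n x _; rewrite mule_ge0 ?lee_fin.
  - move=> x _ a b ab; rewrite lee_wpmul2r ?lee_fin//.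
    exact/lefP/nd_nnsfun_approx.
congr (limn _); apply/funext => n.
transitivity (\int[nu]_x
   (\sum_(y \in range (h n)) (y * \1_(h n @^-1` [set y]) x)%:E)).
  by apply: eq_integral => t _; rewrite /= fimfunE -fsumEFin.
have mind r : measurable_fun setT (fun x => (r * \1_(h n @^-1` [set r]) x)%:E).
  by apply/measurable_EFinP; exact: measurable_funM.
rewrite ge0_integral_fsum//; last by move=> y x _; exact: nnfun_muleindic_ge0.
transitivity (\int[m]_x
   (\sum_(y \in range (h n)) ((y * \1_(h n @^-1` [set y]) x)%:E * (rho x)%:E)));
    last first.
  apply: eq_integral => t _; rewrite [in RHS]fimfunE -fsumEFin//.
  by rewrite ge0_mule_fsuml// => y; exact: nnfun_muleindic_ge0.
have mE : measurable_fun setT (EFin \o rho) by exact/measurable_EFinP.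
rewrite ge0_integral_fsum//; last 2 first.
- by move=> y; exact: emeasurable_funM.
- by move=> y x _; rewrite mule_ge0 ?lee_fin//; exact: nnfun_muleindic_ge0.
apply: eq_fsbigr => r; rewrite inE => -[z _ <-].
have z0 : (0 <= h n z)%R by [].
under eq_integral do rewrite EFinM.
under [RHS]eq_integral do rewrite EFinM -muleA.
rewrite !ge0_integralZl//.
- congr (_ * _); rewrite integral_indic//= setIT /mdensity integral_mkcond.
  apply: eq_integral => x _; rewrite patchE indicE.
  by case: ifPn => _; rewrite ?mul1e ?mul0e.
- by apply: emeasurable_funM => //; exact/measurable_EFinP.
- by move=> x _; rewrite mule_ge0 ?lee_fin.
- exact/measurable_EFinP.
Qed.

End density.

(** The measure structure of an image measure depends on a proof that f is measurable; packing it
    lets laws be handled as plain measures. *)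
Lemma pushforward_measure d d' (T1 : measurableType d) (T2 : measurableType d')
    (R : realType) (m : {measure set T1 -> \bar R}) (f : T1 -> T2) :
  measurable_fun setT f ->
  {m' : {measure set T2 -> \bar R} | m' = pushforward m f :> (set T2 -> \bar R)}.
Proof.
by move=> mf; unshelve eexists (pushforward m f : {measure set T2 -> \bar R}).
Qed.

Section markov.
Context (R : realType) (dO dT : measure_display) (Omega : measurableType dO)
  (T : measurableType dT) (P : probability Omega R)
  (mu : {sigma_finite_measure set T -> \bar R}) (s : T * T -> R)
  (X : nat -> Omega -> T).
Hypothesis Xs : markov_chain P mu s X.
Local Open Scope ereal_scope.

(** [Omega] carrying the sigma-algebra of X_0, ..., X_i: being determined by the past becomes
    ordinary measurability on this type. *)
Local Notation pastType i := (g_sigma_algebraType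
  [set E | exists j : nat, (j <= i)%N /\
     exists B : set T, measurable B /\ E = X j @^-1` B]).

Let mX i : measurable_fun setT (X i). Proof. by case: Xs. Qed.
Let ms : measurable_fun setT s. Proof. by case: Xs => -[]. Qed.
Let s0 z : (0 <= s z)%R. Proof. by case: Xs => -[]. Qed.

Let past_measurable i (E : set Omega) : past X i E -> measurable E.
Proof.
apply: smallest_sub; first exact: sigma_algebra_measurable.
move=> _ [j [_ [B [mB ->]]]]; rewrite -[X j @^-1` B]setTI; exact: mX.
Qed.

Lemma measurable_past i j : (j <= i)%N ->
  measurable_fun setT (X j : pastType i -> T).
Proof.
move=> ji _ B mB; rewrite setTI; apply: sub_sigma_algebra.
by exists j; split => //; exists B.
Qed.

(** Both sides integrate h against a measure on [pastType i * T]: the law [m1] of (w, X_{i+1} w),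
    and the image [m2] of P x mu weighted by s (X_i w, y). The Markov condition says that they agree
    on rectangles, a pi-system generating the product sigma-algebra. *)
Lemma markov_integral i (h : pastType i * T -> \bar R) :
  measurable_fun setT h -> (forall z, 0 <= h z) ->
  \int[P]_w h (w, X i.+1 w) =
  \int[P]_w \int[mu]_y (h (w, y) * (s (X i w, y))%:E).
Proof.
move=> mh h0.
have mid : measurable_fun setT (idfun : Omega -> pastType i).
  by move=> _ B mB; rewrite setTI; exact: (past_measurable mB).
have mphi : measurable_fun setT (fun w : Omega => (w : pastType i, X i.+1 w)).
  exact: measurable_fun_pair.
have mid2 : measurable_fun setT
    (fun z : Omega * T => (z.1 : pastType i, z.2)).
  apply: measurable_fun_pair => //; exact: (measurableT_comp mid measurable_fst).
have mr : measurable_fun setT (fun z : Omega * T => s (X i z.1, z.2)).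
  apply: (measurableT_comp ms); apply: measurable_fun_pair => //.
  exact: (measurableT_comp (mX i)).
have r0 (z : Omega * T) : (0 <= s (X i z.1, z.2))%R by exact: s0.
have fubini_s (f : Omega * T -> \bar R) : measurable_fun setT f ->
    (forall z, 0 <= f z) ->
    \int[mdensity (P \x mu) mr r0]_z f z =
    \int[P]_w \int[mu]_y (f (w, y) * (s (X i w, y))%:E).
  move=> mf f0; rewrite integral_mdensity// fubini_tonelli1//.
    by apply: emeasurable_funM => //; exact/measurable_EFinP.
  by move=> z; rewrite mule_ge0 ?lee_fin.
have [m1 m1E] := pushforward_measure P mphi.
have [m2 m2E] := pushforward_measure (mdensity (P \x mu) mr r0) mid2.
have m12 C : measurable C -> m1 C = m2 C.
  apply: (measure_unique [set A `*` B | A in measurable & B in measurable]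
    (fun=> setT)).
  - by rewrite measurable_prod_measurableType.
  - move=> _ _ [A mA [B mB <-]] [A' mA' [B' mB' <-]].
    exists (A `&` A'); first exact: measurableI.
    by exists (B `&` B'); [exact: measurableI|rewrite setXI].
  - by move=> _; exists setT => //; exists setT => //; rewrite setXTT.
  - by rewrite bigcup_const.
  - move=> _ [A mA [B mB <-]].
    have mA' : measurable (A : set Omega) by exact: (past_measurable mA).
    rewrite m1E m2E /pushforward.
    have -> : (fun w : Omega => (w : pastType i, X i.+1 w)) @^-1` (A `*` B) =
        A `&` X i.+1 @^-1` B by [].
    have -> : (fun z : Omega * T => (z.1 : pastType i, z.2)) @^-1` (A `*` B) =
        (A : set Omega) `*` B by [].
    have [_ _ HX] := Xs.
    transitivity (\int[P]_(w in (A : set Omega)) \int[mu]_(y in B)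
        (s (X i w, y))%:E); first exact: HX.
    transitivity (\int[mdensity (P \x mu) mr r0]_z
        (\1_((A : set Omega) `*` B) z)%:E); last first.
      by rewrite integral_indic ?setIT//; exact: measurableX.
    rewrite fubini_s//; last first.
      apply/measurable_EFinP; apply: measurable_indic.
      exact: measurableX.
    rewrite integral_mkcond; apply: eq_integral => w _.
    rewrite patchE; case: ifPn => [wA|wA]; last first.
      rewrite integral0_eq// => y _; rewrite indicE.
      by rewrite [_ \in _](_ : _ = false) ?mul0e//; apply: contraNF wA;
        rewrite !inE => -[].
    rewrite integral_mkcond; apply: eq_integral => y _.
    rewrite patchE indicE [_ \in _ `*` _](_ : _ = (y \in B)).
      by case: ifPn => _; rewrite ?mul1e ?mul0e.
    rewrite inE in wA; apply/idP/idP; rewrite !inE; first by case.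
    by move=> yB; split.
  - move=> _; rewrite m1E /pushforward preimage_setT.
    exact: (le_lt_trans (probability_le1 P measurableT) (ltry _)).
transitivity (\int[m1]_z h z).
  by rewrite m1E ge0_integral_pushforward.
transitivity (\int[m2]_z h z).
  by apply: eq_measure_integral => C mC _; exact: m12.
rewrite m2E ge0_integral_pushforward// preimage_setT.
rewrite fubini_s//; first by exact: measurableT_comp.
by move=> z; exact: h0.
Qed.

(** Given the past, f is constant and comes out of the inner integral, while the factor g (X_i,
    X_{i+1}) is replaced by its conditional mean, at most 1. *)
Lemma markov_expectation i (f : Omega -> R) (g : T * T -> R) :
  measurable_fun setT (f : pastType i -> R) -> (forall w, (0 <= f w)%R) ->
  measurable_fun setT g -> (forall z, (0 <= g z)%R) ->
  (forall x, \int[mu]_y (g (x, y) * s (x, y))%:E <= 1) ->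
  \int[P]_w (f w * g (X i w, X i.+1 w))%:E <= \int[P]_w (f w)%:E.
Proof.
move=> mf f0 mg g0 gs1.
pose h (z : pastType i * T) := (f z.1 * g (X i z.1, z.2))%:E.
have mh : measurable_fun setT h.
  apply/measurable_EFinP; apply: measurable_funM.
    by apply: (measurableT_comp mf).
  apply: (measurableT_comp mg); apply: measurable_fun_pair => //.
  by apply: (measurableT_comp (measurable_past (leqnn i))).
rewrite (markov_integral mh); last by move=> z; rewrite lee_fin mulr_ge0.
have mid : measurable_fun setT (idfun : Omega -> pastType i).
  by move=> _ B mB; rewrite setTI; exact: (past_measurable mB).
have mf' : measurable_fun setT (f : Omega -> R) by exact: (measurableT_comp mf).
have mgs : measurable_fun setT (fun z : T * T => (g z * s z)%:E).
  by apply/measurable_EFinP; exact: measurable_funM.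
have mgsx x : measurable_fun setT (fun y => (g (x, y) * s (x, y))%:E).
  exact: (measurableT_comp mgs (pair1_measurable x)).
have gs0 z : 0 <= (g z * s z)%:E by rewrite lee_fin mulr_ge0.
have -> : \int[P]_w \int[mu]_y (h (w, y) * (s (X i w, y))%:E) =
    \int[P]_w ((f w)%:E * \int[mu]_y (g (X i w, y) * s (X i w, y))%:E).
  apply: eq_integral => w _; rewrite -ge0_integralZl//; last first.
    by rewrite lee_fin.
  by apply: eq_integral => y _; rewrite /h -!EFinM mulrA.
apply: ge0_le_integral => //.
- by move=> w _; rewrite mule_ge0 ?lee_fin//; exact: integral_ge0.
- apply: emeasurable_funM; first exact/measurable_EFinP.
  have mF := measurable_fun_fubini_tonelli_F (m2 := mu) _ mgs gs0.
  exact: (measurableT_comp mF (mX i)).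
- exact/measurable_EFinP.
- by move=> w _; rewrite -[leRHS]mule1 lee_wpmul2l ?lee_fin.
Qed.

(** The partial products form a supermartingale: the first k factors depend on X_0, ..., X_k only,
    and the last factor is removed by conditioning. *)
Lemma markov_prod_le1 k (g : T * T -> R) :
  measurable_fun setT g -> (forall z, (0 <= g z)%R) ->
  (forall x, \int[mu]_y (g (x, y) * s (x, y))%:E <= 1) ->
  \int[P]_w (\prod_(i < k) g (X i w, X i.+1 w))%:E <= 1.
Proof.
move=> mg g0 gs1; elim: k => [|k IHk].
  under eq_integral do rewrite big_ord0.
  by rewrite integral_cst// mul1e probability_le1.
under eq_integral do rewrite big_ord_recr/=.
apply: (le_trans _ IHk); apply: markov_expectation => //; last first.
  by move=> w; exact: prodr_ge0.
apply: measurable_prod => i _; apply: (measurableT_comp mg).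
apply: measurable_fun_pair; apply: measurable_past => //.
exact: ltnW.
Qed.

End markov.

(** * Robust tests between square roots of densities *)

Lemma measurable_sqrtr (R : realType) : measurable_fun setT (@Num.sqrt R).
Proof. by apply: continuous_measurable_fun; exact: sqrt_continuous. Qed.

Lemma measurable_score (R : realType) d (Z : measurableType d) (f g : Z -> R) :
  (forall z, 0 <= f z) -> (forall z, 0 <= g z) ->
  measurable_fun setT f -> measurable_fun setT g ->
  measurable_fun setT (fun z => score (f z) (g z)).
Proof.
move=> f0 g0 mf mg.
(* The inverse is written as a power, a measurable function agreeing with it at 0 as well. *)
rewrite (_ : (fun z => _) = fun z => 2 * (g z - f z) * powR (f z + g z) (-1)).
  apply: measurable_funM.
    by apply: measurable_funM => //; exact: measurable_funB.
  by apply: (measurableT_comp (measurable_powR _)); exact: measurable_funD.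
by apply/funext => z; rewrite powR_inv1// addr_ge0.
Qed.

Section one_step.
Context d (T : measurableType d) (R : realType)
  (mu : {measure set T -> \bar R}).
Implicit Types f g h : T -> R.
Local Notation int f := (mu.-integrable setT (EFin \o f)).

Let intD f g : int f -> int g -> int (fun y => f y + g y).
Proof. exact: integrableD. Qed.

Let intB f g : int f -> int g -> int (fun y => f y - g y).
Proof. exact: integrableB. Qed.

Let intZ c f : int f -> int (fun y => c * f y).
Proof. exact: integrableZl. Qed.

Lemma integrable_sqr f : measurable_fun setT f ->
  (\int[mu]_y (f y ^+ 2)%:E < +oo)%E -> int (fun y => f y ^+ 2).
Proof.
move=> mf fy; apply/integrableP; split.
  exact/measurable_EFinP/measurable_funX.
under eq_integral => y _ do rewrite /= ger0_norm ?sqr_ge0//.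
exact: fy.
Qed.

Lemma integrable_sqrB f g : measurable_fun setT f -> measurable_fun setT g ->
  int (fun y => f y ^+ 2) -> int (fun y => g y ^+ 2) ->
  int (fun y => (f y - g y) ^+ 2).
Proof.
move=> mf mg If Ig.
apply: (@le_integrable _ _ _ mu setT measurableT _
    (EFin \o (fun y => 2 * f y ^+ 2 + 2 * g y ^+ 2))).
- by apply/measurable_EFinP; apply: measurable_funX; exact: measurable_funB.
- move=> y _; rewrite /= lee_fin ger0_norm ?sqr_ge0// ger0_norm; last first.
    by rewrite addr_ge0// mulr_ge0// sqr_ge0.
  by have := sqr_ge0 (f y + g y); nra.
- by apply: intD; exact: intZ.
Qed.

(** Integrated form of (x + y)^2 <= 2 x^2 + 2 y^2, the only triangle inequality used for L^2
    distances. The integral of g^2 may be infinite. *)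
Lemma le_integral_sqrD f g h (c : R) : measurable_fun setT f ->
  measurable_fun setT g -> measurable_fun setT h ->
  (forall y, `|h y| <= `|f y| + `|g y|) ->
  (\int[mu]_y (f y ^+ 2)%:E <= c%:E)%E ->
  (\int[mu]_y (h y ^+ 2)%:E <= (2 * c)%:E + 2%:E * \int[mu]_y (g y ^+ 2)%:E)%E.
Proof.
move=> mf mg mh fgh fc.
have sq0 (k : T -> R) (y : T) : setT y -> (0 <= (k y ^+ 2)%:E)%E.
  by rewrite lee_fin sqr_ge0.
have msq (k : T -> R) : measurable_fun setT k ->
    measurable_fun setT (fun y => (k y ^+ 2)%:E).
  by move=> mk; apply/measurable_EFinP; exact: measurable_funX.
apply: (@le_trans _ _ (2%:E * \int[mu]_y (f y ^+ 2)%:E +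
    2%:E * \int[mu]_y (g y ^+ 2)%:E)%E); last first.
  by apply: leeD => //; rewrite EFinM lee_wpmul2l.
rewrite -!ge0_integralZl//; [|by apply: msq|by move=> y _; rewrite lee_fin sqr_ge0
  |by apply: msq|by move=> y _; rewrite lee_fin sqr_ge0].
rewrite -ge0_integralD//; last 4 first.
- by move=> y _; rewrite mule_ge0// lee_fin sqr_ge0.
- by apply: measurable_funeM; exact: msq.
- by move=> y _; rewrite mule_ge0// lee_fin sqr_ge0.
- by apply: measurable_funeM; exact: msq.
apply: ge0_le_integral => //.
- exact: sq0.
- exact: msq.
- by apply: emeasurable_funD; apply: measurable_funeM; exact: msq.
- move=> y _; rewrite -!EFinM -EFinD lee_fin.
  rewrite -[h y ^+ 2]real_normK ?num_real// -[f y ^+ 2]real_normK ?num_real//.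
  rewrite -[g y ^+ 2]real_normK ?num_real//.
  have := fgh y; have := normr_ge0 (h y); have := sqr_ge0 (`|f y| - `|g y|).
  nra.
Qed.

Variables a b t s : T -> R.
Hypotheses (ma : measurable_fun setT a) (mb : measurable_fun setT b)
  (mt : measurable_fun setT t) (ms : measurable_fun setT s).
Hypotheses (a0 : forall y, 0 <= a y) (b0 : forall y, 0 <= b y)
  (t0 : forall y, 0 <= t y) (s0 : forall y, 0 <= s y).
Hypothesis ts : forall y, t y ^+ 2 = s y \/ [/\ a y = 0, b y = 0 & t y = 0].
Hypotheses (s1 : (\int[mu]_y (s y)%:E = 1)%E)
  (a_lty : (\int[mu]_y (a y ^+ 2)%:E < +oo)%E)
  (b_lty : (\int[mu]_y (b y ^+ 2)%:E < +oo)%E).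

(* To be used with the squared norms N, N' of two candidates, their squared
   distances Q, Q' to sqrt s, and their values x, y at the observed transition. *)
Definition comparison (N N' Q Q' x y : R) : R :=
  expR ((score x y + (N - N') / 2 - 3 * Q + Q' / 8) / 128).

(** Pointwise the integrand is at most exp (- u) F, where F integrates to 1 + u <= exp u. The two
    cases of [ts] are the points inside and outside A: t is the root of s 1_A, and the candidates
    vanish off A. *)
Lemma comparison_integral_le1 :
  (\int[mu]_y (comparison
      (\int[mu]_y (a y ^+ 2))%R (\int[mu]_y (b y ^+ 2))%R
      (\int[mu]_y ((t y - a y) ^+ 2))%R (\int[mu]_y ((t y - b y) ^+ 2))%R
      (a y) (b y) * s y)%:E <= 1)%E.
Proof.
set Na := (\int[mu]_y (a y ^+ 2))%R; set Nb := (\int[mu]_y (b y ^+ 2))%R.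
set Qa := (\int[mu]_y ((t y - a y) ^+ 2))%R.
set Qb := (\int[mu]_y ((t y - b y) ^+ 2))%R.
have Is : int s.
  apply/integrableP; split; first exact/measurable_EFinP.
  under eq_integral => y _ do rewrite /= ger0_norm//.
  by rewrite s1 ltry.
have Ia := integrable_sqr ma a_lty; have Ib := integrable_sqr mb b_lty.
have It : int (fun y => t y ^+ 2).
  apply: (@le_integrable _ _ _ mu setT measurableT _ (EFin \o s)) => //.
    exact/measurable_EFinP/measurable_funX.
  move=> y _ /=; rewrite lee_fin ger0_norm ?sqr_ge0// ger0_norm//.
  by have [->//|[_ _ ->]] := ts y; rewrite expr0n.
have Ita := integrable_sqrB mt ma It Ia; have Itb := integrable_sqrB mt mb It Ib.
(* u is the integral of the correction to t^2 in [exp_score], and F is the right side of [exp_score]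
   with s in place of t^2; 256 and 1024 are 2 * 128 and 8 * 128. *)
pose u := ((Nb - Na) / 2 + 3 * Qa - Qb / 8) / 128.
pose F y := s y + (256^-1 * (b y ^+ 2 - a y ^+ 2) +
  (3 / 128 * (t y - a y) ^+ 2 - 1024^-1 * (t y - b y) ^+ 2)).
have Iba : int (fun y => 256^-1 * (b y ^+ 2 - a y ^+ 2)).
  by apply: intZ; exact: intB.
have Iab : int (fun y => 3 / 128 * (t y - a y) ^+ 2).
  exact: intZ.
have Ibb : int (fun y => 1024^-1 * (t y - b y) ^+ 2).
  exact: intZ.
have IF : int F.
  apply: intD => //; apply: intD => //.
  exact: intB.
have FE : (\int[mu]_y F y)%R = 1 + u.
  rewrite RintegralD//; last first.
    apply: intD => //.
    exact: intB.
  rewrite RintegralD//; last exact: intB.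
  rewrite RintegralB// !RintegralZl//; last exact: intB.
  rewrite RintegralB// -/Na -/Nb -/Qa -/Qb /Rintegral s1 /u /=.
  by field.
have le_F y : comparison Na Nb Qa Qb (a y) (b y) * s y <= expR (- u) * F y.
  rewrite /comparison.
  have -> : (score (a y) (b y) + (Na - Nb) / 2 - 3 * Qa + Qb / 8) / 128 =
      - u + score (a y) (b y) / 128 by rewrite /u; field.
  rewrite expRD -mulrA ler_wpM2l ?expR_ge0// /F.
  have [<-|[-> -> tE]] := ts y.
    have := exp_score (a0 y) (b0 y) (t0 y).
    rewrite -(sqrrN (a y - t y)) -(sqrrN (b y - t y)) !opprB; lra.
  (* Off A the score and the correction both vanish, so both sides equal exp (- u) s. *)
  rewrite tE /score !subrr mulr0 !mul0r expR0 expr0n/=; lra.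
have Iexp : int (fun y => expR (- u) * F y) by exact: intZ.
apply: (@le_trans _ _ (\int[mu]_y (expR (- u) * F y)%:E)%E).
  apply: ge0_le_integral => //.
  - by move=> y _; rewrite lee_fin mulr_ge0// expR_ge0.
  - apply/measurable_EFinP; apply: measurable_funM => //.
    apply: (measurableT_comp (@measurable_expR R)).
    apply: measurable_funM => //; apply: measurable_funD => //.
    apply: measurable_funD => //; apply: measurable_funD => //.
    exact: measurable_score.
  - exact: (measurable_int _ Iexp).
  - by move=> y _; rewrite lee_fin.
rewrite -[X in (X <= _)%E]fineK; last exact: (integrable_fin_num measurableT Iexp).
rewrite lee_fin; change ((\int[mu]_y (expR (- u) * F y))%R <= 1).
rewrite RintegralZl// FE expRN ler_pdivrMl ?expR_gt0// mulr1.
exact: expR_ge1Dx.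
Qed.

End one_step.

(** * Selection by pairwise tests *)

(** The function is a finite sum over the boolean patterns v of G v times the indicator of c z = v,
    which is a product of indicators over j. *)
Lemma measurable_finite_choice (R : realType) d (Z : measurableType d)
    (J : finType) (c : Z -> {ffun J -> bool}) (G : {ffun J -> bool} -> Z -> R) :
  (forall j, measurable_fun setT (fun z => c z j)) ->
  (forall v, measurable_fun setT (G v)) ->
  measurable_fun setT (fun z => G (c z) z).
Proof.
move=> mc mG.
rewrite (_ : (fun z => _) =
    fun z => \sum_(v : {ffun J -> bool})
      (\prod_j (c z j == v j)%:R) * G v z); last first.
  apply/funext => z; rewrite (bigD1 (c z))//= !big1 ?mul1r ?addr0// => [v vc|].
    have [j cj] : exists j, c z j != v j.
      apply/existsP; rewrite -negb_forall; apply: contra vc => /forallP cv.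
      by apply/eqP/ffunP => j; exact/esym/eqP.
    by rewrite (bigD1 j)//= (negbTE cj) !mul0r.
  by move=> j _; rewrite eqxx.
apply: measurable_sum => v; apply: measurable_funM => //.
apply: measurable_prod => j _.
have mb : measurable_fun setT (fun b : bool => (b == v j)%:R : R) by [].
exact: (measurableT_comp mb (mc j)).
Qed.

Section selection.
Context (R : realType) (dT : measure_display) (T : measurableType dT)
  (mu : {sigma_finite_measure set T -> \bar R}) (n : nat)
  (I : finType) (a : I -> T * T -> R) (Delta : I -> R).
Hypotheses (ma : forall k, measurable_fun setT (a k))
  (a0 : forall k z, 0 <= a k z)
  (a_lty : forall k x, (\int[mu]_y (a k (x, y) ^+ 2)%:E < +oo)%E).

Definition sqnorm (k : I) (x : T) : R := (\int[mu]_y (a k (x, y) ^+ 2))%R.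

Definition transition (x : n.+1.-tuple T) (i : 'I_n) : T * T :=
  (tnth x (widen_ord (leqnSn n) i), tnth x (lift ord0 i)).

(** Positive values speak for [l] against [k]; exchanging [k] and [l] changes the sign. *)
Definition test_stat (k l : I) (x : n.+1.-tuple T) : R :=
  \sum_(i < n) (score (a k (transition x i)) (a l (transition x i)) +
    (sqnorm k (transition x i).1 - sqnorm l (transition x i).1) / 2).

(** The exponentials involve [test_stat] divided by 128, so penalties enter multiplied by 128. *)
Definition crit (k l : I) (x : n.+1.-tuple T) : R :=
  test_stat k l x + 128 * (Delta k - Delta l).

Definition crit_order (x : n.+1.-tuple T) : {ffun (I * I) * (I * I) -> bool} :=
  [ffun p => crit p.1.1 p.1.2 x <= crit p.2.1 p.2.2 x].

(* Selects a minimizer k of max_l crit k l: since the data enter only through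
   finitely many comparisons, measurability is immediate. *)
Definition selected (c : {ffun (I * I) * (I * I) -> bool}) : option I :=
  [pick k | [forall k', [forall l, [exists l', c ((k, l), (k', l'))]]]].

Definition selector (x : n.+1.-tuple T) (z : T * T) : R :=
  if selected (crit_order x) is Some k then a k z ^+ 2 else 0.

(** The search cannot fail: the index minimizing over k the maximum over l of [crit k l] passes its
    test. [k0] shows that the index set is inhabited. *)
Lemma selectedP (x : n.+1.-tuple T) (k0 : I) : exists k,
  selected (crit_order x) = Some k /\
  forall k' l, exists l', crit k l x <= crit k' l' x.
Proof.
rewrite /selected; case: pickP => [k /forallP kP|noP].
  exists k; split=> // k' l; have /forallP/(_ l)/existsP[l'] := kP k'.
  by rewrite ffunE => ?; exists l'.
pose worst k := [arg max_(l > k0) crit k l x]%O.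
have worstP k l : crit k l x <= crit k (worst k) x.
  by rewrite /worst; case: arg_maxP => // l' _; exact.
pose best := [arg min_(k < k0) crit k (worst k) x]%O.
have := noP best; move=> /negbT/negP[]; apply/forallP => k'; apply/forallP => l.
apply/existsP; exists (worst k'); rewrite ffunE/=; apply: le_trans (worstP _ _) _.
by rewrite /best; case: arg_minP => // k _; exact.
Qed.

Let msqr k : measurable_fun setT (fun z => (a k z ^+ 2)%:E).
Proof. by apply/measurable_EFinP; exact: measurable_funX. Qed.

Lemma measurable_sqnorm k : measurable_fun setT (sqnorm k).
Proof.
apply: (measurableT_comp (@fine_measurable R setT measurableT)).
apply: (measurable_fun_fubini_tonelli_F (m2 := mu) _ (msqr k)) => z.
by rewrite lee_fin sqr_ge0.
Qed.

Lemma measurable_transition i : measurable_fun setT (transition ^~ i).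
Proof. by apply: measurable_fun_pair; exact: measurable_tnth. Qed.

Lemma measurable_crit k l : measurable_fun setT (crit k l).
Proof.
apply: measurable_funD => //; apply: measurable_sum => i.
have mi := measurable_transition i.
have mi1 := measurableT_comp measurable_fst mi.
apply: measurable_funD.
  apply: measurable_score => //; exact: (measurableT_comp (ma _) mi).
apply: measurable_funM => //; apply: measurable_funB;
  exact: (measurableT_comp (measurable_sqnorm _) mi1).
Qed.

Lemma measurable_crit_order p :
  measurable_fun setT (fun x => crit_order x p).
Proof.
rewrite (_ : (fun x => _) =
    (fun x => crit p.1.1 p.1.2 x <= crit p.2.1 p.2.2 x)); last first.
  by apply/funext => x; rewrite ffunE.
by apply: measurable_fun_ler; exact: measurable_crit.
Qed.

Lemma selector_is_estimator : is_estimator mu selector.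
Proof.
split.
- apply: (measurable_finite_choice (c := fun w => crit_order w.1)
    (G := fun v w => if selected v is Some k then a k w.2 ^+ 2 else 0)) => [p|v].
    exact: (measurableT_comp (measurable_crit_order p) measurable_fst).
  case: selected => [k|//]; apply: measurable_funX.
  exact: (measurableT_comp (ma k) measurable_snd).
- by move=> x z; rewrite /selector; case: selected => // k; exact: sqr_ge0.
- move=> x i; rewrite /selector; case: selected => [k|]; first exact: a_lty.
  by under eq_integral do rewrite /=; rewrite integral0 ltry.
Qed.

(** * Risk of the selected candidate *)

Section risk.
Context (dO : measure_display) (Omega : measurableType dO)
  (P : probability Omega R) (s : T * T -> R) (X : nat -> Omega -> T)
  (A : set (T * T)).
Hypotheses (mA : measurable A) (aA : forall k z, ~ A z -> a k z = 0)
  (Xs : markov_chain P mu s X) (sumDelta : \sum_k expR (- Delta k) <= 1).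

Let t (z : T * T) : R := Num.sqrt (s z * \1_A z).

Let ms : measurable_fun setT s. Proof. by case: Xs => -[]. Qed.
Let s0 z : 0 <= s z. Proof. by case: Xs => -[]. Qed.
Let s1 x : (\int[mu]_y (s (x, y))%:E = 1)%E. Proof. by case: Xs => -[]. Qed.
Let mX i : measurable_fun setT (X i). Proof. by case: Xs. Qed.

Let mt : measurable_fun setT t.
Proof.
apply: (measurableT_comp (@measurable_sqrtr R)).
by apply: measurable_funM => //; exact: measurable_indic.
Qed.

Let t0 z : 0 <= t z. Proof. exact: sqrtr_ge0. Qed.

Let tsE z : t z ^+ 2 = s z * \1_A z.
Proof. by rewrite sqr_sqrtr// mulr_ge0. Qed.

Definition sqloss (k : I) (x : T) : R :=
  (\int[mu]_y ((t (x, y) - a k (x, y)) ^+ 2))%R.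

Let fib (f : T * T -> R) x : measurable_fun setT f ->
  measurable_fun setT (fun y => f (x, y)).
Proof. by move=> mf; exact: (measurableT_comp mf (pair1_measurable x)). Qed.

Let t_lty x : (\int[mu]_y (t (x, y) ^+ 2)%:E < +oo)%E.
Proof.
apply: (@le_lt_trans _ _ (\int[mu]_y (s (x, y))%:E)%E); last by rewrite s1 ltry.
apply: ge0_le_integral => //.
- by move=> y _; rewrite lee_fin sqr_ge0.
- by apply/measurable_EFinP; apply: measurable_funX; exact: fib.
- by apply/measurable_EFinP; exact: fib.
- by move=> y _; rewrite tsE lee_fin indicE; case: (_ \in _);
    rewrite ?mulr1 ?mulr0.
Qed.

Lemma sqlossE k x :
  (sqloss k x)%:E = (\int[mu]_y ((t (x, y) - a k (x, y)) ^+ 2)%:E)%E.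
Proof.
rewrite /sqloss /Rintegral fineK//; apply: integrable_fin_num => //.
apply: integrable_sqrB; try exact: fib.
  by apply: integrable_sqr => //; exact: fib.
by apply: integrable_sqr => //; exact: fib.
Qed.

Lemma measurable_sqloss k : measurable_fun setT (sqloss k).
Proof.
apply: (measurableT_comp (@fine_measurable R setT measurableT)).
apply: (measurable_fun_fubini_tonelli_F (m2 := mu)
  (fun z => ((t z - a k z) ^+ 2)%:E)) => [|z].
  by apply/measurable_EFinP; apply: measurable_funX; exact: measurable_funB.
by rewrite lee_fin sqr_ge0.
Qed.

Lemma sqloss_ge0 k x : 0 <= sqloss k x.
Proof. by apply: Rintegral_ge0 => y _; exact: sqr_ge0. Qed.

Definition ratio (k l : I) (z : T * T) : R :=
  comparison (sqnorm k z.1) (sqnorm l z.1) (sqloss k z.1) (sqloss l z.1)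
    (a k z) (a l z).

Lemma ratio_integral_le1 k l x :
  (\int[mu]_y (ratio k l (x, y) * s (x, y))%:E <= 1)%E.
Proof.
apply: (@comparison_integral_le1 _ T R mu (fun y => a k (x, y))
  (fun y => a l (x, y)) (fun y => t (x, y)) (fun y => s (x, y)));
  rewrite ?s1//; try exact: fib.
move=> y; rewrite tsE indicE; have [xyA|xyA] := boolP ((x, y) \in A).
  by left; rewrite mulr1.
have nA : ~ A (x, y) by move=> h; move/negP: xyA; apply; rewrite inE.
right; split; [exact: aA|exact: aA|].
by rewrite /t indicE (negbTE xyA) mulr0 sqrtr0.
Qed.

Lemma measurable_ratio k l : measurable_fun setT (ratio k l).
Proof.
apply: (measurableT_comp (@measurable_expR R)); apply: measurable_funM => //.
have m1 (f : T -> R) : measurable_fun setT f ->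
    measurable_fun setT (fun z : T * T => f z.1).
  by move=> mf; exact: (measurableT_comp mf measurable_fst).
have mN k' := m1 _ (measurable_sqnorm k').
have mQ k' := m1 _ (measurable_sqloss k').
apply: measurable_funD; last by apply: measurable_funM.
apply: measurable_funB; last by apply: measurable_funM.
apply: measurable_funD; first exact: measurable_score.
by apply: measurable_funM => //; exact: measurable_funB.
Qed.

Definition obs (w : Omega) : n.+1.-tuple T := [tuple X i w | i < n.+1].

Let transition_obs w i : transition (obs w) i = (X i w, X i.+1 w).
Proof. by rewrite /transition !tnth_mktuple. Qed.

(** A mixture, with weights exp (- Delta l), of the exponentials testing [k] against every [l]: one
    variable of mean at most 1 controls all the tests of [k] simultaneously. *)
Definition excess (k : I) (w : Omega) : R :=
  \sum_l expR (- Delta l) * \prod_(i < n) ratio k l (X i w, X i.+1 w).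

(** The term of index l in [excess] has the form exp y and is at most the whole sum; y <= exp y
    bounds the statistic. *)
Lemma test_stat_le (k l : I) w :
  test_stat k l (obs w) <= 3 * (\sum_(i < n) sqloss k (X i w))
    - (\sum_(i < n) sqloss l (X i w)) / 8 + 128 * (Delta l + excess k w).
Proof.
set S := (X in X <= _).
set Qk := \sum_(i < n) sqloss k _; set Ql := \sum_(i < n) sqloss l _.
have ge0 l' : 0 <= expR (- Delta l') *
    \prod_(i < n) ratio k l' (X i w, X i.+1 w).
  by rewrite mulr_ge0 ?expR_ge0// prodr_ge0// => i _; exact: expR_ge0.
have : expR (- Delta l) * \prod_(i < n) ratio k l (X i w, X i.+1 w)
    <= excess k w.
  by rewrite /excess (bigD1 l)//= lerDl sumr_ge0.
rewrite -expR_sum -expRD => H.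
have : (S - 3 * Qk + Ql / 8) / 128 - Delta l <= excess k w.
  apply: le_trans H; rewrite (_ : _ - _ = - Delta l + \sum_(i < n) (
    (score (a k (X i w, X i.+1 w)) (a l (X i w, X i.+1 w)) +
    (sqnorm k (X i w) - sqnorm l (X i w)) / 2 - 3 * sqloss k (X i w)
     + sqloss l (X i w) / 8) / 128)).
    by apply: le_trans (expR_ge1Dx _); rewrite lerDr.
  rewrite addrC; congr (_ + _); rewrite -mulr_suml; congr (_ / _).
  rewrite /S /test_stat /Qk /Ql mulr_sumr mulr_suml -sumrB -big_split/=.
  by apply: eq_bigr => i _; rewrite transition_obs/= !tnth_mktuple.
lra.
Qed.

Lemma test_statN k l x : test_stat k l x = - test_stat l k x.
Proof.
rewrite /test_stat -sumrN; apply: eq_bigr => i _.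
by rewrite scoreN; lra.
Qed.

(** By minimality crit k k0 <= crit k0 l for some l. Antisymmetry turns both sides into tests of
    [k0], to which [test_stat_le] applies; the penalties of k and l cancel. Multiplying by 8 gives
    48 = 8 * 6 and 2048 = 8 * 256. *)
Lemma selected_sqloss_le k0 k w : selected (crit_order (obs w)) = Some k ->
  \sum_(i < n) sqloss k (X i w) <=
    48 * \sum_(i < n) sqloss k0 (X i w) + 2048 * (Delta k0 + excess k0 w).
Proof.
move=> sk; have [k1 [+ kP]] := selectedP (obs w) k0.
rewrite sk => -[k1E]; rewrite -{k1}k1E in kP.
have [l] := kP k0 k0; rewrite /crit test_statN.
have := test_stat_le k0 k w; have := test_stat_le k0 l w.
have : 0 <= \sum_(i < n) sqloss l (X i w).
  by apply: sumr_ge0 => i _; exact: sqloss_ge0.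
lra.
Qed.

Lemma excess_ge0 k w : 0 <= excess k w.
Proof.
apply: sumr_ge0 => l _; rewrite mulr_ge0 ?expR_ge0// prodr_ge0// => i _.
exact: expR_ge0.
Qed.

Let mXX i : measurable_fun setT (fun w => (X i w, X i.+1 w)).
Proof. exact: measurable_fun_pair. Qed.

Let mprod k l :
  measurable_fun setT (fun w => \prod_(i < n) ratio k l (X i w, X i.+1 w)).
Proof.
apply: measurable_prod => i _.
exact: (measurableT_comp (measurable_ratio k l) (mXX i)).
Qed.

Lemma measurable_excess k : measurable_fun setT (excess k).
Proof. by apply: measurable_sum => l; apply: measurable_funM. Qed.

(** Each product of ratios has mean at most 1 by the Markov property, and the weights sum to at most
    1. *)
Lemma excess_expectation_le1 k : (\int[P]_w (excess k w)%:E <= 1)%E.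
Proof.
have prod_ge0 l w : (0 <= (\prod_(i < n) ratio k l (X i w, X i.+1 w))%:E)%E.
  by rewrite lee_fin prodr_ge0// => i _; exact: expR_ge0.
under eq_integral => w _ do rewrite /excess -sumEFin.
rewrite ge0_integral_sum//; last 2 first.
- by move=> l; apply/measurable_EFinP; exact: measurable_funM.
- by move=> l w _; rewrite EFinM mule_ge0// lee_fin expR_ge0.
apply: (@le_trans _ _ (\sum_l (expR (- Delta l))%:E)%E); last first.
  by rewrite sumEFin lee_fin.
apply: lee_sum => l _.
under eq_integral do rewrite EFinM.
rewrite ge0_integralZl//; last exact/measurable_EFinP.
rewrite -[leRHS]mule1 lee_wpmul2l ?lee_fin ?expR_ge0//.
apply: (markov_prod_le1 Xs) => [|z|x].
- exact: measurable_ratio.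
- exact: expR_ge0.
- exact: ratio_integral_le1.
Qed.

Lemma hellinger2_selector w k : selected (crit_order (obs w)) = Some k ->
  hellinger2 mu n (X ^~ w) (fun z => s z * \1_A z) (selector (obs w)) =
  ((2 * n%:R)^-1 * \sum_(i < n) sqloss k (X i w))%:E.
Proof.
move=> sk; rewrite /hellinger2 EFinM -sumEFin; congr (_ * _)%E.
apply: eq_bigr => i _; rewrite sqlossE; apply: eq_integral => y _.
by rewrite /selector sk sqrtr_sqr ger0_norm.
Qed.

Lemma selector_risk k0 :
  (\int[P]_w hellinger2 mu n (X ^~ w) (fun z => s z * \1_A z)%R
     (selector (obs w)) <=
   (2 * n%:R)^-1%:E *
     (48%:E * (\sum_(i < n) \int[P]_w \int[mu]_y
        ((Num.sqrt (s (X i w, y) * \1_A (X i w, y)) - a k0 (X i w, y)) ^+ 2)%R%:E)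
      + (2048 * (Delta k0 + 1))%R%:E))%E.
Proof.
have c1_ge0 : 0 <= 48 :> R by exact: ler0n.
have c2_ge0 : 0 <= 2048 :> R by exact: ler0n.
have sel_le := @selected_sqloss_le k0.
(* Unary numerals: unification must not see the values of c1 and c2. *)
set c1 : R := 48 in c1_ge0 sel_le *; set c2 : R := 2048 in c2_ge0 sel_le *.
clearbody c1 c2.
have D0 : 0 <= Delta k0.
  rewrite -oppr_le0 -(@ler_expR R) expR0; apply: le_trans sumDelta.
  by rewrite (bigD1 k0)//= lerDl sumr_ge0// => l _; exact: expR_ge0.
have Q0 k w : 0 <= \sum_(i < n) sqloss k (X i w).
  by apply: sumr_ge0 => i _; exact: sqloss_ge0.
have n0 : 0 <= (2 * n%:R)^-1 :> R by rewrite invr_ge0 mulr_ge0.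
have mQi k i : measurable_fun setT (fun w => sqloss k (X i w)).
  exact: (measurableT_comp (measurable_sqloss k) (mX i)).
have mQ k : measurable_fun setT (fun w => \sum_(i < n) sqloss k (X i w)).
  exact: measurable_sum.
have mobs : measurable_fun setT obs.
  apply/measurable_fun_tnthP => i.
  by rewrite (_ : _ \o _ = X i)//; apply/funext => w /=; rewrite tnth_mktuple.
(* The selected index is random, so the measurability of its loss comes from
   [measurable_finite_choice]. *)
pose L w := if selected (crit_order (obs w)) is Some k
  then \sum_(i < n) sqloss k (X i w) else 0.
have mL : measurable_fun setT L.
  apply: (measurable_finite_choice (c := crit_order \o obs)
    (G := fun v w => if selected v is Some k
       then \sum_(i < n) sqloss k (X i w) else 0)) => [p|v].
    exact: (measurableT_comp (measurable_crit_order p) mobs).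
  by case: selected.
have hL w : hellinger2 mu n (X ^~ w) (fun z => s z * \1_A z) (selector (obs w))
    = ((2 * n%:R)^-1 * L w)%:E.
  have [k [sk _]] := selectedP (obs w) k0.
  by rewrite (hellinger2_selector sk) /L sk.
under eq_integral do rewrite hL EFinM.
have L0 w : 0 <= L w by rewrite /L; case: selected.
rewrite ge0_integralZl//; last 2 first.
- exact/measurable_EFinP.
- by move=> w _; rewrite lee_fin.
apply: lee_wpmul2l; first by rewrite lee_fin.
apply: (@le_trans _ _ (\int[P]_w (c1%:E * (\sum_(i < n) sqloss k0 (X i w))%:E +
    c2%:E * ((Delta k0)%:E + (excess k0 w)%:E))%E)%E).
  apply: ge0_le_integral => //.
  - by move=> w _; rewrite lee_fin.
  - exact/measurable_EFinP.
  - apply: emeasurable_funD; apply: measurable_funeM; first exact/measurable_EFinP.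
    by apply: emeasurable_funD => //; exact/measurable_EFinP/measurable_excess.
  - move=> w _; rewrite -EFinD lee_fin /L.
    have [k [sk _]] := selectedP (obs w) k0.
    by rewrite sk; exact: sel_le.
have me := measurable_excess k0.
rewrite ge0_integralD//; last 4 first.
- by move=> w _; rewrite mule_ge0// lee_fin.
- by apply: measurable_funeM; exact/measurable_EFinP.
- by move=> w _; rewrite mule_ge0// adde_ge0// lee_fin// excess_ge0.
- apply: measurable_funeM; apply: emeasurable_funD => //.
  exact/measurable_EFinP.
apply: leeD.
  rewrite ge0_integralZl//; last 2 first.
  - exact/measurable_EFinP.
  - by move=> w _; rewrite lee_fin.
  apply: lee_wpmul2l => //.
  under eq_integral do rewrite -sumEFin.
  rewrite ge0_integral_sum//; last 2 first.
  - by move=> i; exact/measurable_EFinP.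
  - by move=> i w _; rewrite lee_fin sqloss_ge0.
  by apply: lee_sum => i _; under eq_integral do rewrite sqlossE.
rewrite ge0_integralZl//; last 2 first.
- by apply: emeasurable_funD => //; exact/measurable_EFinP.
- by move=> w _; rewrite adde_ge0// lee_fin// excess_ge0.
rewrite EFinM; apply: lee_wpmul2l => //.
rewrite ge0_integralD//; last 2 first.
- by move=> w _; rewrite lee_fin excess_ge0.
- exact/measurable_EFinP.
rewrite integral_cst//= probability_setT mule1 EFinD leeD2l//.
exact: excess_expectation_le1.
Qed.

End risk.
End selection.

(** * Grids in finite-dimensional models *)

Section model_net.
Context d (Z : measurableType d) (R : realType) (m : {measure set Z -> \bar R}).

Local Notation L2fun := (LfunType m (lee1n 2)).
(** On functions, not classes, this form is only semi-definite: null functions are isotropic. *)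
Let B (f g : L2fun) : R := (\int[m]_z (f z * g z))%R.

Let intM (f g : L2fun) : m.-integrable setT (EFin \o (fun z => f z * g z)).
Proof. exact/Lfun1_integrable/Lfun2_mul_Lfun1/LfunP/LfunP. Qed.

Let B_linear a (f g h : L2fun) : B (a *: f + g) h = a * B f h + B g h.
Proof.
rewrite -RintegralZl// -RintegralD//; last first.
  exact: (integrableZl measurableT a (intM f h)).
by apply: eq_Rintegral => z _ /=; rewrite mulrDl mulrA.
Qed.

Let BE (f : L2fun) : (B f f)%:E = (\int[m]_z (f z ^+ 2)%:E)%E.
Proof.
rewrite /B /Rintegral fineK; last first.
  exact: (integrable_fin_num measurableT (intM f f)).
by apply: eq_integral => z _; rewrite expr2.
Qed.

Let BC f g : B f g = B g f.
Proof. by apply: eq_Rintegral => z _; rewrite mulrC. Qed.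

Let B_ge0 f : 0 <= B f f.
Proof. by apply: Rintegral_ge0 => z _; rewrite -expr2 sqr_ge0. Qed.

Let L2_sum D (c : 'I_D -> R) (e : 'I_D -> L2fun) z :
  (\sum_k c k *: e k : L2fun) z = \sum_k c k * e k z.
Proof. exact: (big_morph (fun f : L2fun => f z)). Qed.

Lemma measurable_Lspace (g : LspaceType2 m) : measurable_fun setT (g : Z -> R).
Proof. exact: (measurable_funP (repr (g : aeEqMfun _ _))). Qed.

(** Every g in V equals almost everywhere a combination f of the representatives of a basis, so
    [grid_net] applied to f serves for g. *)
Lemma model_net (V : set (LspaceType2 m)) (D n : nat) : (0 < n)%N ->
  has_dim V D -> exists F : {ffun 'I_D -> 'I_(4 * n + 1)} -> Z -> R,
    (forall q, measurable_fun setT (F q)) /\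
    (forall g : LspaceType2 m, V g -> (\int[m]_z (g z ^+ 2)%:E <= 4%:E)%E ->
      exists q, (\int[m]_z ((g z - F q z) ^+ 2)%:E
                  <= (D%:R / n%:R ^+ 2)%:E)%E).
Proof.
move=> n0 [e [_ ->]].
have eL k : (e k : Z -> R) \in Lfun m 2.
  apply/andP; split; rewrite inE; first exact: measurable_Lspace.
  exact: Lebesgue_finite.
pose e' k : L2fun := Lfun_Sub (lee1n 2) (eL k).
have [F FP] := grid_net (B := B) BC B_linear B_ge0 e' n0.
exists (fun q => F q : Z -> R).
split=> [q|g [c gE] g4]; first exact: measurable_funP.
pose f := \sum_k c k *: e' k.
have fE z : f z = \sum_k c k * e k z by rewrite L2_sum.
have msq (h : Z -> R) : measurable_fun setT h ->
    measurable_fun setT (fun z => (h z ^+ 2)%:E).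
  by move=> mh; apply/measurable_EFinP; exact: measurable_funX.
have mf (h : L2fun) : measurable_fun setT h by exact: measurable_funP.
have mg := measurable_Lspace g.
have [|q fq] := FP c.
  rewrite -lee_fin BE; apply: le_trans g4; rewrite le_eqVlt; apply/orP; left.
  apply/eqP; apply: ae_eq_integral => //; [exact: msq|exact: msq|].
  by apply: filterS gE => z gz _; rewrite gz -fE.
exists q; rewrite -lee_fin BE in fq; apply: le_trans fq.
rewrite le_eqVlt; apply/orP; left.
apply/eqP; apply: ae_eq_integral => //.
- by apply: msq; exact: measurable_funB.
- by apply: msq.
- by apply: filterS gE => z gz _; rewrite gz -fE.
Qed.
End model_net.

(** * Truncation and integration over rectangles *)

(** The restriction of m to D is the measure with density 1_D with respect to m. *)
Lemma ge0_integral_mrestr d (Z : measurableType d) (R : realType)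
    (m : {measure set Z -> \bar R}) (D : set Z) (mD : measurable D)
    (f : Z -> \bar R) : measurable_fun setT f -> (forall z, 0 <= f z)%E ->
  (\int[mrestr m mD]_z f z = \int[m]_(z in D) f z)%E.
Proof.
move=> mf f0; have m1 : measurable_fun setT (\1_D : Z -> R) by [].
have p1 z : 0 <= (\1_D z : R) by [].
transitivity (\int[mdensity m m1 p1]_z f z)%E.
  apply: eq_measure_integral => C mC _.
  by rewrite [RHS]/= /mdensity integral_indic// setIC.
rewrite integral_mdensity// [RHS]integral_mkcond; apply: eq_integral => z _.
by rewrite patchE indicE; case: ifPn => _; rewrite ?mule1 ?mule0.
Qed.

Section truncation.
Context (R : realType) (dT : measure_display) (T : measurableType dT)
  (mu : {sigma_finite_measure set T -> \bar R}) (A : set (T * T)).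
Hypothesis mA : measurable A.

Definition pos_part (v : T * T -> R) (z : T * T) : R := Num.max (v z) 0 * \1_A z.

(** Each section is kept or erased as a whole. The bound 4 makes every section square integrable, as
    an estimator requires, and bounds the loss at every state, X_0 included. *)
Definition truncation (v : T * T -> R) (z : T * T) : R :=
  if (\int[mu]_y (pos_part v (z.1, y) ^+ 2)%:E <= 4%:E)%E
  then pos_part v z else 0.

Lemma pos_part_ge0 v z : 0 <= pos_part v z.
Proof. by rewrite mulr_ge0// le_max lexx orbT. Qed.

Lemma truncation_ge0 v z : 0 <= truncation v z.
Proof. by rewrite /truncation; case: ifP => // _; exact: pos_part_ge0. Qed.

Lemma truncation_notin v z : ~ A z -> truncation v z = 0.
Proof.
move=> nA; rewrite /truncation; case: ifP => // _.
by rewrite /pos_part indicE memNset// mulr0.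
Qed.

Lemma measurable_pos_part v : measurable_fun setT v ->
  measurable_fun setT (pos_part v).
Proof.
move=> mv; apply: measurable_funM; last exact: measurable_indic.
exact: measurable_maxr.
Qed.

Lemma measurable_truncation v : measurable_fun setT v ->
  measurable_fun setT (truncation v).
Proof.
move=> mv; have mp := measurable_pos_part mv.
apply: measurable_fun_ifT => //.
have mI : measurable_fun setT (fun x => \int[mu]_y (pos_part v (x, y) ^+ 2)%:E)%E.
  apply: (measurable_fun_fubini_tonelli_F (m2 := mu)
    (fun z => (pos_part v z ^+ 2)%:E)) => [|z].
    by apply/measurable_EFinP; exact: measurable_funX.
  by rewrite lee_fin sqr_ge0.
apply: measurable_fun_lee => //.
exact: (measurableT_comp mI measurable_fst).
Qed.

Lemma truncation_norm v x :
  (\int[mu]_y (truncation v (x, y) ^+ 2)%:E <= 4%:E)%E.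
Proof.
rewrite /truncation /=.
case: (boolP (\int[mu]_y (pos_part v (x, y) ^+ 2)%:E <= 4%:E)%E) => // _.
by rewrite integral0_eq ?lee_fin// => y _; rewrite expr0n.
Qed.

(* A section with norm larger than 2 is further away from t (x, .), whose norm
   is at most 1, than 0 is. *)
Lemma truncation_dist v (t : T * T -> R) x : measurable_fun setT v ->
  measurable_fun setT t -> (forall z, 0 <= t z) -> (forall z, ~ A z -> t z = 0) ->
  (\int[mu]_y (t (x, y) ^+ 2)%:E <= 1)%E ->
  (\int[mu]_y ((t (x, y) - truncation v (x, y)) ^+ 2)%:E <=
   \int[mu]_y ((t (x, y) - v (x, y)) ^+ 2 * \1_A (x, y))%:E)%E.
Proof.
move=> mv mt t0 tA t1.
have mx (f : T * T -> R) : measurable_fun setT f ->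
    measurable_fun setT (fun y => f (x, y)).
  by move=> mf; exact: (measurableT_comp mf (pair1_measurable x)).
have mp := measurable_pos_part mv.
have mtp : measurable_fun setT (fun y => (t (x, y) - pos_part v (x, y)) ^+ 2).
  by apply: measurable_funX; apply: measurable_funB; exact: mx.
(* As t is non-negative and vanishes off A, the positive part on A is at least as close to t. *)
have le_p : (\int[mu]_y ((t (x, y) - pos_part v (x, y)) ^+ 2)%:E <=
   \int[mu]_y ((t (x, y) - v (x, y)) ^+ 2 * \1_A (x, y))%:E)%E.
  apply: ge0_le_integral => //.
  - by move=> y _; rewrite lee_fin sqr_ge0.
  - exact/measurable_EFinP.
  - apply/measurable_EFinP; apply: (mx (fun z => (t z - v z) ^+ 2 * \1_A z)).
    apply: measurable_funM; last exact: measurable_indic.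
    by apply: measurable_funX; exact: measurable_funB.
  - move=> y _; rewrite lee_fin /pos_part indicE.
    have [xyA|xyA] := boolP ((x, y) \in A).
      rewrite !mulr1; have := t0 (x, y).
      by case: (leP (v (x, y)) 0) => h ty; nra.
    rewrite !mulr0 tA ?subr0 ?expr0n//.
    by move=> h; move/negP: xyA; apply; rewrite inE.
rewrite /truncation /=.
case: (boolP (\int[mu]_y (pos_part v (x, y) ^+ 2)%:E <= 4%:E)%E) => // big4.
under eq_integral => y _ do rewrite subr0.
apply: (le_trans t1); apply: le_trans le_p.
(* If the squared distance from t to the positive part were below 1, the squared norm of the latter
   would be at most 2 + 2 = 4. *)
rewrite -ltNge in big4; rewrite leNgt; apply/negP => lt1.
move: big4; apply/negP; rewrite -leNgt.
set J := (\int[mu]_y _)%E in lt1.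
have := @le_integral_sqrD _ _ _ mu (fun y => t (x, y))
  (fun y => t (x, y) - pos_part v (x, y)) (fun y => pos_part v (x, y)) 1
  (mx _ mt) _ (mx _ mp) _ t1.
move=> H; apply: le_trans (H _ _) _.
- by apply: measurable_funB; exact: mx.
- move=> y; rewrite -{1}(subKr (t (x, y)) (pos_part v (x, y))).
  exact: ler_normB.
- rewrite -/J -[leRHS](_ : (2 * 1)%:E + 2%:E = 4%:E)%E; last first.
    by rewrite -EFinD; congr EFin; lra.
  by apply: leeD => //; rewrite -[leRHS]mule1 lee_wpmul2l// ltW.
Qed.

End truncation.

(** * From the law of the chain to the reference measure *)

Section density_bound.
Context (R : realType) (dT : measure_display) (T : measurableType dT)
  (mu : {sigma_finite_measure set T -> \bar R})
  (nu : {measure set T -> \bar R}) (A1 A2 : set T)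
  (mA1 : measurable A1) (mA2 : measurable A2).
Hypothesis nuA1 : nu A1 = 1%E.
Local Open Scope ereal_scope.

Let nuA1_fin : nu A1 < +oo. Proof. by rewrite nuA1 ltry. Qed.

(** nu is not assumed sigma-finite, so Tonelli is applied to its restriction [nu1] to A1, which is
    finite; the two product measures agree inside A1 x A2. *)
Lemma integral_rectangle (f : T * T -> \bar R) : measurable_fun setT f ->
  (forall z, 0 <= f z) -> (forall z, ~ (A1 `*` A2) z -> f z = 0) ->
  \int[nu \x mu]_z f z = \int[nu]_(x in A1) \int[mu]_y f (x, y).
Proof.
move=> mf f0 fA.
have mA := measurableX mA1 mA2.
pose nu1 := mfrestr mA1 nuA1_fin.
have fE : \int[nu \x mu]_z f z = \int[nu \x mu]_(z in A1 `*` A2) f z.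
  rewrite [RHS]integral_mkcond; apply: eq_integral => z _.
  rewrite patchE; case: ifPn => // zA; apply: fA.
  by move=> h; move/negP: zA; apply; rewrite inE.
have fE1 : \int[nu1 \x mu]_z f z = \int[nu1 \x mu]_(z in A1 `*` A2) f z.
  rewrite [RHS]integral_mkcond; apply: eq_integral => z _.
  rewrite patchE; case: ifPn => // zA; apply: fA.
  by move=> h; move/negP: zA; apply; rewrite inE.
have res (g : T -> \bar R) : measurable_fun setT g -> (forall x, 0 <= g x) ->
    \int[nu1]_x g x = \int[nu]_(x in A1) g x.
  exact: ge0_integral_mrestr.
rewrite fE; transitivity (\int[nu1 \x mu]_(z in A1 `*` A2) f z).
  apply: eq_measure_integral => C mC CA; rewrite /= /product_measure1/=.
  rewrite res//; last exact: (measurable_fun_xsection mu mC).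
  rewrite [RHS]integral_mkcond; apply: eq_integral => x _.
  rewrite patchE; case: ifPn => // xA1.
  rewrite (_ : xsection C x = set0) ?measure0//.
  apply/seteqP; split => // y; rewrite /xsection/= inE => /CA[/= h _].
  by move/negP: xA1; apply; rewrite inE.
rewrite -fE1 fubini_tonelli1// res//.
- exact: measurable_fun_fubini_tonelli_F.
- by move=> x; apply: integral_ge0.
Qed.

(** The law of Y has density phi, at most kappa where F can be nonzero. The absolute value gives a
    non-negative factor for every real kappa. *)
Lemma density_expectation (dO : measure_display) (Omega : measurableType dO)
    (P : probability Omega R) (Y : Omega -> T) (phi : T -> R) (kappa : R)
    (F : T -> \bar R) :
  measurable_fun setT Y -> has_density P nu Y phi ->
  (forall x, A1 x -> phi x <= kappa)%R ->
  measurable_fun setT F -> (forall x, 0 <= F x) -> (forall x, ~ A1 x -> F x = 0) ->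
  \int[P]_w F (Y w) <= `|kappa|%:E * \int[nu]_(x in A1) F x.
Proof.
move=> mY [mphi phi0 PY] phik mF F0 FA.
have mFA : measurable_fun setT (F \_ A1).
  by apply/(measurable_restrictT (D := A1)) => //; exact: measurable_funTS.
have -> : \int[P]_w F (Y w) = \int[mdensity nu mphi phi0]_x F x.
  have [m mE] := pushforward_measure P mY.
  transitivity (\int[m]_x F x); first by rewrite mE ge0_integral_pushforward.
  by apply: eq_measure_integral => C mC _; rewrite mE; exact: (PY C mC).
rewrite integral_mdensity// (integral_mkcond A1) -ge0_integralZl//; last first.
  by move=> x _; rewrite patchE; case: ifPn.
apply: ge0_le_integral => //.
- by move=> x _; rewrite mule_ge0// lee_fin.
- by apply: emeasurable_funM => //; exact/measurable_EFinP.
- exact: measurable_funeM.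
- move=> x _; rewrite patchE; case: ifPn => [xA|xA].
    rewrite muleC lee_wpmul2r// lee_fin (le_trans _ (ler_norm _))// phik//.
    by rewrite inE in xA.
  by rewrite FA ?mul0e ?mule0// => h; move/negP: xA; apply; rewrite inE.
Qed.

End density_bound.

Section rectangle.
Context (R : realType) (dT : measure_display) (T : measurableType dT)
  (mu : {sigma_finite_measure set T -> \bar R})
  (nu : {measure set T -> \bar R}) (A1 A2 : set T)
  (mA1 : measurable A1) (mA2 : measurable A2) (nuA1 : nu A1 = 1%E)
  (dO : measure_display) (Omega : measurableType dO)
  (P : probability Omega R) (s : T * T -> R) (X : nat -> Omega -> T)
  (Xs : markov_chain P mu s X).

Local Notation A := (A1 `*` A2).

Let t (z : T * T) : R := Num.sqrt (s z * \1_A z).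

Let ms : measurable_fun setT s. Proof. by case: Xs => -[]. Qed.
Let s0 z : 0 <= s z. Proof. by case: Xs => -[]. Qed.
Let s1 x : (\int[mu]_y (s (x, y))%:E = 1)%E. Proof. by case: Xs => -[]. Qed.
Let mX i : measurable_fun setT (X i). Proof. by case: Xs. Qed.
Let mA : measurable A. Proof. exact: measurableX. Qed.

Let mt : measurable_fun setT t.
Proof.
apply: (measurableT_comp (@measurable_sqrtr R)).
by apply: measurable_funM => //; exact: measurable_indic.
Qed.

Let t0 z : 0 <= t z. Proof. exact: sqrtr_ge0. Qed.

Let tE z : t z = Num.sqrt (s z) * \1_A z.
Proof.
rewrite /t indicE; case: (_ \in _); rewrite ?mulr1// mulr0 sqrtr0//.
by rewrite mulr0.
Qed.

Let tA z : ~ A z -> t z = 0.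
Proof. by move=> nA; rewrite tE indicE memNset// mulr0. Qed.

Lemma sqrt_density_norm x :
  (\int[mu]_y (Num.sqrt (s (x, y) * \1_A (x, y)) ^+ 2)%R%:E <= 1)%E.
Proof.
rewrite -(s1 x); apply: ge0_le_integral => //.
- apply/measurable_EFinP; apply: measurable_funX.
  exact: (measurableT_comp mt (pair1_measurable x)).
- apply/measurable_EFinP; exact: (measurableT_comp ms (pair1_measurable x)).
- move=> y _; rewrite lee_fin sqr_sqrtr ?mulr_ge0// indicE.
  by case: (_ \in _); rewrite ?mulr1 ?mulr0.
Qed.

Let set_integral (f : T * T -> R) : measurable_fun setT f ->
  (forall z, 0 <= f z) ->
  (\int[(nu \x mu)%E]_(z in A) (f z)%:E =
    \int[nu]_(x in A1) \int[mu]_y (f (x, y) * \1_A (x, y))%:E)%E.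
Proof.
move=> mf f0; rewrite -(@integral_rectangle _ _ _ mu nu A1 A2 mA1 mA2 nuA1
  (fun z => (f z * \1_A z)%:E)).
- rewrite [LHS]integral_mkcond; apply: eq_integral => z _.
  by rewrite patchE indicE; case: ifPn; rewrite ?mulr1 ?mulr0.
- apply/measurable_EFinP; apply: measurable_funM => //; exact: measurable_indic.
- by move=> z; rewrite lee_fin mulr_ge0.
- by move=> z nA; rewrite indicE memNset// mulr0.
Qed.

Lemma density_integral_le1 : (\int[(nu \x mu)%E]_(z in A) (s z)%:E <= 1)%E.
Proof.
rewrite set_integral// -nuA1 -[leRHS]mul1e -integral_cst//.
have mF : measurable_fun setT (fun x => \int[mu]_y (s (x, y) * \1_A (x, y))%:E)%E.
  apply: (measurable_fun_fubini_tonelli_F (m2 := mu)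
    (fun z => (s z * \1_A z)%:E)) => [|z].
    by apply/measurable_EFinP; apply: measurable_funM => //; exact: measurable_indic.
  by rewrite lee_fin mulr_ge0.
apply: ge0_le_integral => //.
- by move=> x _; apply: integral_ge0 => y _; rewrite lee_fin mulr_ge0.
- exact: measurable_funTS.
- move=> x _; apply: le_trans (sqrt_density_norm x).
  rewrite le_eqVlt; apply/orP; left; apply/eqP; apply: eq_integral => y _.
  by rewrite sqr_sqrtr// mulr_ge0.
Qed.

(** [truncation_dist] removes the truncation on each section, [density_expectation] replaces the law
    of X_i by nu, and Tonelli on the rectangle recovers the distance in L^2. *)
Lemma truncation_expectation (i : nat) (phi : T -> R) (kappa : R) (v : T * T -> R) :
  has_density P nu (X i) phi -> (forall x, A1 x -> phi x <= kappa) ->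
  measurable_fun setT v ->
  (\int[P]_w \int[mu]_y ((Num.sqrt (s (X i w, y) * \1_A (X i w, y))
        - truncation mu A v (X i w, y)) ^+ 2)%R%:E
   <= `|kappa|%:E *
      \int[(nu \x mu)%E]_(z in A) ((Num.sqrt (s z) - v z) ^+ 2)%R%:E)%E.
Proof.
move=> Xphi phik mv.
have msv : measurable_fun setT (fun z => (Num.sqrt (s z) - v z) ^+ 2).
  apply: measurable_funX; apply: measurable_funB => //.
  exact: (measurableT_comp (@measurable_sqrtr R)).
pose G (z : T * T) := ((Num.sqrt (s z) - v z) ^+ 2 * \1_A z)%:E.
have mG : measurable_fun setT G.
  by apply/measurable_EFinP; apply: measurable_funM => //; exact: measurable_indic.
have G0 z : (0 <= G z)%E by rewrite lee_fin mulr_ge0// sqr_ge0.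
have mF := measurable_fun_fubini_tonelli_F (m2 := mu) G mG G0.
have mtv : measurable_fun setT (truncation mu A v) by exact: measurable_truncation.
rewrite set_integral//; last by move=> z; exact: sqr_ge0.
have := density_expectation mA1 (mX i) Xphi phik mF.
move=> H; apply: le_trans (H _ _).
- apply: ge0_le_integral => //.
  + by move=> w _; apply: integral_ge0 => y _; rewrite lee_fin sqr_ge0.
  + have m2 := measurable_fun_fubini_tonelli_F (m2 := mu)
      (fun z => ((t z - truncation mu A v z) ^+ 2)%:E).
    apply: (measurableT_comp (m2 _ _) (mX i)) => [|z].
      apply/measurable_EFinP; apply: measurable_funX; exact: measurable_funB.
    by rewrite lee_fin sqr_ge0.
  + exact: (measurableT_comp mF (mX i)).
  + move=> w _; apply: le_trans (truncation_dist _ mv mt t0 tA _) _ => //.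
      exact: sqrt_density_norm.
    rewrite le_eqVlt; apply/orP; left; apply/eqP; apply: eq_integral => y _.
    rewrite /G tE indicE; case: (_ \in _); by rewrite ?mulr1 ?mulr0.
- by move=> x; apply: integral_ge0 => y _.
- move=> x nA1; rewrite /fubini_F integral0_eq// => y _.
  by rewrite /G indicE memNset ?mulr0// => -[].
Qed.

(** Squared norms at most 1 and 4 on each section give 2 * 1 + 2 * 4. No density of X_i enters, so
    this covers X_0. *)
Lemma truncation_expectation_le10 (i : nat) (v : T * T -> R) :
  measurable_fun setT v ->
  (\int[P]_w \int[mu]_y ((Num.sqrt (s (X i w, y) * \1_A (X i w, y))
        - truncation mu A v (X i w, y)) ^+ 2)%R%:E <= 10%:E)%E.
Proof.
move=> mv.
have mtv : measurable_fun setT (truncation mu A v) by exact: measurable_truncation.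
have m2 := measurable_fun_fubini_tonelli_F (m2 := mu)
      (fun z => ((t z - truncation mu A v z) ^+ 2)%:E).
have mF : measurable_fun setT (fun w => \int[mu]_y
    ((t (X i w, y) - truncation mu A v (X i w, y)) ^+ 2)%R%:E)%E.
  apply: (measurableT_comp (m2 _ _) (mX i)) => [|z].
    by apply/measurable_EFinP; apply: measurable_funX; exact: measurable_funB.
  by rewrite lee_fin sqr_ge0.
apply: (@le_trans _ _ (\int[P]_w (cst 10%:E w))%E); last first.
  rewrite integral_cst//= probability_setT mule1//.
apply: ge0_le_integral => //.
  by move=> w _; apply: integral_ge0 => y _; rewrite lee_fin sqr_ge0.
move=> w _.
have mx (f : T * T -> R) : measurable_fun setT f ->
    measurable_fun setT (fun y => f (X i w, y)).
  by move=> mf; exact: (measurableT_comp mf (pair1_measurable _)).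
have := @le_integral_sqrD _ _ _ mu (fun y => t (X i w, y))
  (fun y => truncation mu A v (X i w, y))
  (fun y => t (X i w, y) - truncation mu A v (X i w, y)) 1
  (mx _ mt) (mx _ mtv) _ _ (sqrt_density_norm _).
move=> H; apply: le_trans (H _ _) _.
- by apply: measurable_funB; exact: mx.
- by move=> y; exact: ler_normB.
- rewrite -[leRHS](_ : (2 * 1)%:E + 2%:E * 4%:E = 10%:E)%E; last first.
    by rewrite -EFinM -EFinD; congr EFin; lra.
  by apply: leeD => //; rewrite lee_wpmul2l// truncation_norm.
Qed.

End rectangle.

(** * Numerical constants *)

Lemma ln_ge1 (R : realType) (n : nat) : (3 < n)%N -> 1 <= ln n%:R :> R.
Proof.
move=> n3; have n4 : 4 <= n%:R :> R by rewrite (ler_nat R 4).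
rewrite -[leLHS](expRK 1) ler_ln ?posrE ?expR_gt0//; last by lra.
(* The quadratic bound at 1 / 2 gives exp (1 / 2) <= 2, hence e <= 4. *)
apply: le_trans n4; have -> : 1 = 1 / 2 + 1 / 2 :> R by lra.
rewrite expRD; have := @expR_le_quadratic R (1 / 2) (lexx _).
have := expR_gt0 (1 / 2 : R); nra.
Qed.

Lemma ln_grid (R : realType) (n : nat) : (3 < n)%N ->
  ln (4 * n + 1)%:R <= 3 * ln n%:R :> R.
Proof.
move=> n3; have n0 : 0 < n%:R :> R by rewrite ltr0n; lia.
rewrite mulr_natl -lnXn// ler_ln ?posrE ?exprn_gt0// ?ltr0n ?addn1//.
by rewrite -natrX ler_nat; nia.
Qed.

(** The 10 from X_0 contributes 240 / n. The penalty contributes 1024 * 5, since log (4 n + 1) <= 3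
    log n and the two units are absorbed by 2 D log n. Together they make 5360, and 48 k comes from
    the other observations. *)
Lemma risk_arithmetic (R : realType) (n D : nat) (k d Delta : R) :
  (3 < n)%N -> (0 < D)%N -> 0 <= k -> 0 <= d -> 0 <= Delta ->
  (2 * n%:R)^-1 * (48 * (10 + n%:R * (k * (2 * (D%:R / n%:R ^+ 2) + 2 * d)))
     + 2048 * (Delta + D%:R * ln (4 * n + 1)%:R + 1 + 1))
  <= (5360 + 48 * k) * (d + (Delta + D%:R * ln n%:R) / n%:R).
Proof.
move=> n3 D0 k0 d0 De0.
have L1 := @ln_ge1 R n n3; have Lg := @ln_grid R n n3.
have D1 : 1 <= D%:R :> R by rewrite ler1n.
have N0 : 0 < n%:R :> R by rewrite ltr0n; lia.
move: (ln n%:R) (ln (4 * n + 1)%:R) (D%:R : R) L1 Lg D1 => L L' E L1 Lg D1.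
have N1 : 1 <= n%:R :> R by rewrite ler1n; lia.
move: (n%:R : R) N0 N1 => N N0 N1.
set q := N^-1; have q0 : 0 < q by rewrite invr_gt0.
have q1 : q <= 1 by rewrite invf_le1.
have Nq : N * q = 1 by rewrite mulfV// gt_eqF.
set r := (Delta + E * L) / N.
have rE : r = (Delta + E * L) * q by [].
have EL : E <= E * L by rewrite -[leLHS]mulr1 ler_wpM2l//; lra.
have qr : q <= r by rewrite rE -[leLHS]mul1r ler_wpM2r ?(ltW q0)//; lra.
have h1 : E / N ^+ 2 <= r.
  rewrite -exprVn expr2 -/q mulrA rE ler_wpM2r ?(ltW q0)//.
  have : E * q <= E by rewrite -[leRHS]mulr1 ler_wpM2l//; lra.
  lra.
have h2 : (Delta + E * L' + 1 + 1) * q <= 5 * r.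
  rewrite rE mulrA ler_wpM2r ?(ltW q0)//.
  have : E * L' <= E * (3 * L) by rewrite ler_wpM2l//; lra.
  lra.
have -> : (2 * N)^-1 * (48 * (10 + N * (k * (2 * (E / N ^+ 2) + 2 * d))) +
    2048 * (Delta + E * L' + 1 + 1)) =
    240 * q + 24 * (N * q) * (k * (2 * (E / N ^+ 2) + 2 * d)) +
    1024 * ((Delta + E * L' + 1 + 1) * q).
  by rewrite /q; field; rewrite gt_eqF.
rewrite Nq.
have h3 : k * (2 * (E / N ^+ 2) + 2 * d) <= k * (2 * r + 2 * d).
  by rewrite ler_wpM2l//; lra.
have r0 : 0 <= r by lra.
have : 0 <= k * d by rewrite mulr_ge0.
lra.
Qed.

Lemma trivial_risk_arithmetic (R : realType) (n : nat) : (0 < n)%N ->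
  (2 * n%:R)^-1 * (48 * (10 * n%:R) + 2048 * (1 + 1)) <= 5360 :> R.
Proof.
move=> n0; have N1 : 1 <= n%:R :> R by rewrite ler1n.
move: (n%:R : R) N1 => N N1.
rewrite mulrC ler_pdivrMr; lra.
Qed.

(** * Assembling the models *)

(** [model_dim] picks an admissible dimension. It cannot pick 0: V would then contain null functions
    only, among them a member of a free family. *)
Lemma model_dimP (R : realType) d (Z : measurableType d)
    (m : {measure set Z -> \bar R}) (V : set (LspaceType2 m)) :
  is_model V -> has_dim V (model_dim V) /\ (0 < model_dim V)%N.
Proof.
move=> [D [D0 VD]].
have VdimV : has_dim V (model_dim V) by apply: xgetPex; exists D.
split=> //; rewrite lt0n; apply/negP => /eqP dim0.
have [e [efree VE]] := VD; have [e' [_ VE']] := VdimV.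
pose k0 := Ordinal D0; pose c (k : 'I_D) : R := (k == k0)%:R.
have ce z : \sum_(k < D) c k * (e k : Z -> R) z = (e k0 : Z -> R) z.
  rewrite (bigD1 k0)//= /c eqxx mul1r big1 ?addr0// => k /negbTE ->.
  by rewrite mul0r.
have : V (e k0).
  by rewrite VE; exists c; apply: nearW => z; rewrite ce.
rewrite VE' => -[c' ae0].
suff : c k0 = 0 by move/eqP; rewrite /c eqxx oner_eq0.
apply: (efree c); apply: filterS ae0 => z ez; rewrite ce ez big1// => k _.
by have := ltn_ord k; rewrite [X in (_ < X)%N]dim0.
Qed.

Section weights.
Context (R : realType) (K : choiceType) (VV : set K) (Delta : K -> R).
Hypothesis sumD : (\esum_(V in VV) (expR (- Delta V))%:E <= 1)%E.

Lemma sum_weights_le1 (X : {fset K}) : [set` X] `<=` VV ->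
  \sum_(V <- X) expR (- Delta V) <= 1.
Proof.
move=> XV; rewrite -lee_fin; apply: le_trans sumD; apply: esum_ge.
exists [set` X]; first by split; [exact: finite_fset|].
by rewrite fsbig_finite ?finite_fset// set_fsetK sumEFin.
Qed.

(** Each of these indices has weight at least exp (- c), so more than exp c of them would have total
    weight above 1. *)
Lemma finite_small_weight (c : R) : finite_set [set V | VV V /\ Delta V <= c].
Proof.
apply: contrapT => infS.
have [X XS Xn] := infinite_set_fset (Num.truncn (expR c)).+1 infS.
have := @sum_weights_le1 X (fun V XV => (XS V XV).1).
apply/negP; rewrite -ltNge.
apply: (@lt_le_trans _ _ (\sum_(V <- X) expR (- c))); last first.
  rewrite !big_seq; apply: ler_sum => V VX.
  by rewrite ler_expR lerN2; apply: (XS V VX).2.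
rewrite big_const_seq count_predT iter_addr_0 expRN -mulr_natr mulrC.
rewrite ltr_pdivlMr ?expR_gt0// mul1r.
apply: lt_le_trans (truncnS_gt (expR c)) _.
by rewrite ler_nat.
Qed.

End weights.

(* The extra index with value g0 and penalty 1 makes the family nonempty; adding
   1 to the other penalties leaves room for its weight exp (-1). *)
Lemma net_union (R : realType) (G : Type) (J : finType) (D : J -> nat) (N : nat)
    (w : J -> R) (F : forall j, {ffun 'I_(D j) -> 'I_N} -> G) (g0 : G) :
  (0 < N)%N -> \sum_j expR (- w j) <= 1 ->
  exists (I : finType) (g : I -> G) (pen : I -> R),
    [/\ \sum_k expR (- pen k) <= 1,
        forall k, g k = g0 \/ exists j q, g k = F j q,
        exists k, pen k = 1 &
        forall j q, exists k, g k = F j q /\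
          pen k = w j + (D j)%:R * ln N%:R + 1].
Proof.
move=> N0 w1; pose K := {j : J & {ffun 'I_(D j) -> 'I_N}}.
pose penK (p : K) : R := w (tag p) + (D (tag p))%:R * ln N%:R + 1.
exists ('I_1 + K)%type.
exists (fun k => if k is inr p then F (tag p) (tagged p) else g0).
exists (fun k => if k is inr p then penK p else 1); split.
- rewrite big_sumType/= big_ord1.
  have NR : 0 < N%:R :> R by rewrite ltr0n.
  (* The N ^ D j grid points of model j share its weight equally, so D j log N in the penalty
     cancels their number. *)
  have -> : \sum_(p : K) expR (- penK p) = expR (-1) * \sum_j expR (- w j).
    rewrite -(sig_big_dep xpredT (fun=> xpredT) (fun j _ =>
      expR (- (w j + (D j)%:R * ln N%:R + 1))))/= mulr_sumr.
    apply: eq_bigr => j _.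
    have pw : expR (- ((D j)%:R * ln N%:R)) = (N ^ D j)%:R^-1 :> R.
      by rewrite expRN mulrC expRM_natr lnK ?posrE// natrX.
    rewrite sumr_const card_ffun !card_ord -[LHS]mulr_natr !opprD !expRD pw.
    by field; rewrite pnatr_eq0 expn_eq0 negb_and -lt0n N0.
  have e1 : expR (-1) <= 1 / 2 :> R.
    have h : 2 <= expR 1 :> R by have := @expR_ge1Dx R 1; lra.
    by rewrite expRN mul1r lef_pV2 ?posrE ?expR_gt0.
  have := expR_gt0 (-1 : R); nra.
- by case=> [_|p]; [left|right; exists (tag p), (tagged p)].
- by exists (inl ord0).
- by move=> j q; exists (inr (Tagged (fun j => {ffun 'I_(D j) -> 'I_N}) q)).
Qed.

Theorem theorem5 (R : realType) :
  exists C : R -> R, (forall kappa, 0 < C kappa) /\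
  forall (n : nat) (dT : measure_display) (T : measurableType dT)
    (mu : {sigma_finite_measure set T -> \bar R})
    (nu : {measure set T -> \bar R})
    (A1 A2 : set T) (mA1 : measurable A1) (mA2 : measurable A2)
    (VV : set (set (L2 (nu \x mu)%E (measurableX mA1 mA2))))
    (Delta : set (L2 (nu \x mu)%E (measurableX mA1 mA2)) -> R),
  (3 < n)%N ->
  nu A1 = 1%E ->
  countable VV ->
  (forall V, VV V -> is_model V) ->
  (forall V, VV V -> 0 <= Delta V) ->
  (\esum_(V in VV) (expR (- Delta V))%:E <= 1)%E ->
  exists shat : n.+1.-tuple T -> T * T -> R,
    is_estimator mu shat /\
    forall (kappa : R) (dO : measure_display) (Omega : measurableType dO)
      (P : probability Omega R) (s : T * T -> R) (X : nat -> Omega -> T)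
      (phi : nat -> T -> R),
    markov_chain P mu s X ->
    (forall i : nat, (0 < i < n)%N -> has_density P nu (X i) (phi i)) ->
    (forall (i : nat) (x : T), (0 < i < n)%N -> A1 x -> phi i x <= kappa) ->
    ((C kappa)%:E *
       \int[P]_w hellinger2 mu n (fun i => X i w)
                   (fun z => s z * \1_(A1 `*` A2) z)%R
                   (shat [tuple X i w | i < n.+1])
     <= ereal_inf
          [set (L2dist_to (fun z => Num.sqrt (s z)) V) ^+ 2
               + ((Delta V + (model_dim V)%:R * ln n%:R) / n%:R)%R%:E | V in VV])%E.
Proof.
have M_gt0 (kappa : R) : 0 < 5360 + 48 * `|kappa|.
  by have := normr_ge0 kappa; lra.
(* The absolute value makes the constant positive for every real kappa. *)
exists (fun kappa => (5360 + 48 * `|kappa|)^-1).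
split=> [kappa|]; first by rewrite invr_gt0.
move=> n dT T mu nu A1 A2 mA1 mA2 VV Delta n3 nuA1 _ VVm D_ge0 sumD.
set mA := measurableX mA1 mA2 in VV Delta VVm D_ge0 sumD *.
pose A := A1 `*` A2; pose m := mrestr (nu \x mu)%E mA.
have n0 : (0 < n)%N by exact: ltn_trans n3.
(* A model with Delta V > n makes the right side exceed 1, where a crude risk bound suffices; the
   others are finite in number. *)
have /finite_fsetP[S SE] := finite_small_weight sumD n%:R.
have SVV : [set` S] `<=` VV by rewrite -SE => V [].
have SV (j : S) : VV (val j) by apply: SVV; rewrite /=; exact: valP.
pose D (j : S) := model_dim (val j).
have [net netP] : exists net : forall j : S,
    {ffun 'I_(D j) -> 'I_(4 * n + 1)} -> T * T -> R, forall j,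
    (forall q, measurable_fun setT (net j q)) /\
    (forall g : L2 (nu \x mu)%E mA, val j g ->
      (\int[m]_z (g z ^+ 2)%:E <= 4%:E)%E ->
      exists q, (\int[m]_z ((g z - net j q z) ^+ 2)%:E
                  <= ((D j)%:R / n%:R ^+ 2)%:E)%E).
  exists (fun j => sval (cid (model_net n0 (model_dimP (VVm _ (SV j))).1))) => j.
  exact: (svalP (cid (model_net n0 (model_dimP (VVm _ (SV j))).1))).
have sumS : \sum_(j : S) expR (- Delta (val j)) <= 1.
  rewrite -(big_seq_fsetE _ S xpredT (fun V => expR (- Delta V)))/=.
  exact: sum_weights_le1 SVV.
have N0 : (0 < 4 * n + 1)%N by rewrite addn1.
have [I [base [pen [sum_pen baseP [ktriv pen1] knet]]]] :=
  net_union net (cst 0) N0 sumS.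
have mbase k : measurable_fun setT (base k).
  have [->|[j [q ->]]] := baseP k; first exact: measurable_cst.
  by have [] := netP j.
pose a k := truncation mu A (base k).
have mAA : measurable A := mA.
have ma k : measurable_fun setT (a k) by exact: measurable_truncation.
have a_ge0 k z : 0 <= a k z by exact: truncation_ge0.
have a_lty k x : (\int[mu]_y (a k (x, y) ^+ 2)%:E < +oo)%E.
  by apply: le_lt_trans (truncation_norm _ _ _ _) _; rewrite ltry.
have aA k z : ~ A z -> a k z = 0 by exact: truncation_notin.
exists (selector mu a pen); split; first exact: selector_is_estimator.
move=> kappa dO Omega P s X phi Xs dens phik.
set risk := (\int[P]_w _)%E.
pose E i v := (\int[P]_w \int[mu]_y ((Num.sqrt (s (X i w, y) * \1_A (X i w, y))
        - truncation mu A v (X i w, y)) ^+ 2)%R%:E)%E.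
have risk_le k : (risk <= (2 * n%:R)^-1%:E *
     (48%:E * (\sum_(i < n) E i (base k)) + (2048 * (pen k + 1))%R%:E))%E.
  exact: (selector_risk n ma a_ge0 a_lty mAA aA Xs sum_pen).
have N_ge0 : 0 <= n%:R :> R by exact: ler0n.
have risk_leR k (x : R) : (\sum_(i < n) E i (base k) <= x%:E)%E ->
    (risk <= ((2 * n%:R)^-1 * (48 * x + 2048 * (pen k + 1)))%:E)%E.
  move=> Sx; apply: le_trans (risk_le k) _; rewrite [leRHS]EFinM.
  apply: lee_wpmul2l; first by rewrite lee_fin invr_ge0 mulr_ge0.
  rewrite [leRHS]EFinD; apply: leeD => //; rewrite [leRHS]EFinM.
  by apply: lee_wpmul2l => //; rewrite lee_fin ler0n.
have E10 i k : (E i (base k) <= 10%:E)%E.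
  exact: truncation_expectation_le10.
(* Comparison with the extra index of penalty 1 bounds the risk, whatever the models. *)
have risk_triv : (risk <= 5360%:E)%E.
  apply: le_trans (risk_leR ktriv (10 * n%:R) _) _; last first.
    by rewrite lee_fin pen1; exact: trivial_risk_arithmetic.
  apply: (@le_trans _ _ (\sum_(i < n) 10%:E)%E); first by apply: lee_sum.
  by rewrite sumEFin lee_fin sumr_const card_ord mulr_natr.
have main V (g : L2 (nu \x mu)%E mA) : VV V -> V g ->
    (risk <= (5360 + 48 * `|kappa|)%:E *
      (\int[(nu \x mu)%E]_(z in A) ((Num.sqrt (s z) - g z) ^+ 2)%:E +
        ((Delta V + (model_dim V)%:R * ln n%:R) / n%:R)%:E))%E.
  move=> VVV Vg; set r := (_ + _) / _; set I2 := (\int[_]_(_ in A) _)%E.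
  set M := 5360 + 48 * `|kappa|.
  have [Vdim dim_gt0] := model_dimP (VVm _ VVV).
  have L1 : 1 <= ln n%:R :> R by exact: ln_ge1.
  have DL0 : 0 <= (model_dim V)%:R * ln n%:R :> R.
    by rewrite mulr_ge0// (le_trans ler01).
  have r0 : 0 <= r by rewrite divr_ge0// addr_ge0// D_ge0.
  have I0 : (0 <= I2)%E by apply: integral_ge0 => z _; rewrite lee_fin sqr_ge0.
  (* From here on both the squared distance and r may be taken below 1: then V is among the
     discretized models, and g lies in the ball of radius 2. *)
  have big : (1 <= I2 + r%:E)%E -> (risk <= M%:E * (I2 + r%:E))%E.
    move=> Ir; apply: le_trans risk_triv _.
    apply: (@le_trans _ _ (M%:E * 1)%E); last first.
      by apply: lee_wpmul2l => //; rewrite lee_fin ltW// M_gt0.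
    by rewrite mule1 lee_fin /M lerDl mulr_ge0// ler0n.
  have [I1|I1] := leP 1%E I2.
    by apply: big; rewrite -[leLHS]adde0 leeD// lee_fin.
  have [r1|r1] := leP 1 r.
    by apply: big; rewrite -[leLHS]add0e leeD// lee_fin.
  have I2fin : I2 \is a fin_num by rewrite ge0_fin_numE// (lt_trans I1) ?ltry.
  pose d := fine I2; have dE : I2 = d%:E by rewrite fineK.
  have d0 : 0 <= d by rewrite -lee_fin -dE.
  have VS : V \in S.
    have : [set` S] V; last by [].
    rewrite -SE; split=> //.
    move: r1; rewrite /r ltr_pdivrMr ?ltr0n// mul1r => /ltW; apply: le_trans.
    by rewrite lerDl.
  pose j : S := [` VS]%fset.
  have mss : measurable_fun setT (fun z => Num.sqrt (s z)).
    by apply: (measurableT_comp (@measurable_sqrtr R)); case: Xs => -[].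
  have mg := measurable_Lspace g.
  have msg : measurable_fun setT (fun z => Num.sqrt (s z) - g z).
    exact: measurable_funB.
  have IE (f : T * T -> R) : measurable_fun setT f ->
      (\int[m]_z (f z ^+ 2)%:E =
       \int[(nu \x mu)%E]_(z in A) (f z ^+ 2)%:E)%E.
    move=> mf; apply: ge0_integral_mrestr => [|z].
      by apply/measurable_EFinP; exact: measurable_funX.
    by rewrite lee_fin sqr_ge0.
  have s_le1 : (\int[m]_z (Num.sqrt (s z) ^+ 2)%:E <= 1%:E)%E.
    rewrite IE//; apply: le_trans (density_integral_le1 mA1 mA2 nuA1 Xs).
    rewrite le_eqVlt; apply/orP; left; apply/eqP; apply: eq_integral => z _.
    by rewrite sqr_sqrtr//; case: Xs => -[].
  have sgE : (\int[m]_z ((Num.sqrt (s z) - g z) ^+ 2)%:E = d%:E)%E.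
    by rewrite (IE _ msg).
  (* The root of s has norm at most 1 on A and g is within distance 1 of it: 2 + 2 d <= 4. *)
  have g4 : (\int[m]_z (g z ^+ 2)%:E <= 4%:E)%E.
    apply: (le_trans (le_integral_sqrD mss msg mg _ s_le1)) => [z|].
      by rewrite -{1}(subKr (Num.sqrt (s z)) (g z)); exact: ler_normB.
    rewrite sgE -EFinM -EFinD lee_fin.
    have : d <= 1 by rewrite -lee_fin -dE ltW.
    lra.
  have [q gq] := (netP j).2 g Vg g4.
  have mF : measurable_fun setT (net j q) := (netP j).1 q.
  have mgF : measurable_fun setT (fun z => g z - net j q z).
    exact: measurable_funB.
  have msF : measurable_fun setT (fun z => Num.sqrt (s z) - net j q z).
    exact: measurable_funB.
  have := le_integral_sqrD mgF msg msF _ gq.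
  rewrite sgE (IE _ msF) => sF.
  have [k [kF penk]] := knet j q.
  pose B := `|kappa| * (2 * ((model_dim V)%:R / n%:R ^+ 2) + 2 * d).
  have B0 : 0 <= B.
    by rewrite mulr_ge0// addr_ge0// mulr_ge0// divr_ge0// exprn_ge0.
  have EB (i : nat) : (0 < i < n)%N -> (E i (base k) <= B%:E)%E.
    move=> iN; apply: le_trans (truncation_expectation mA1 mA2 nuA1 Xs
      (dens i iN) (phik i ^~ iN) (mbase k)) _.
    rewrite kF EFinM; apply: lee_wpmul2l; first by rewrite lee_fin.
    rewrite EFinD EFinM; apply: le_trans (sF _) _ => // z.
    by rewrite -[X in `|X| <= _](subrKA (g z)) addrC; exact: ler_normD.
  (* X_0 has no density and is charged the crude bound 10; each other term is at most B. *)
  have sumE : (\sum_(i < n) E i (base k) <= (10 + n%:R * B)%:E)%E.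
    apply: (@le_trans _ _ (\sum_(i < n)
        ((if i == Ordinal n0 then 10 else 0) + B)%:E)%E).
      apply: lee_sum => i _; case: eqVneq => [->|i0].
        by apply: le_trans (E10 0 k) _; rewrite lee_fin lerDl.
      rewrite add0r; apply: EB; rewrite ltn_ord andbT lt0n.
      by apply: contra i0 => /eqP i0; exact/eqP/val_inj.
    rewrite sumEFin lee_fin big_split/= sumr_const card_ord -(mulr_natl B).
    by rewrite -big_mkcond big_pred1_eq.
  apply: le_trans (risk_leR k _ sumE) _.
  rewrite dE -EFinD -EFinM lee_fin penk.
  by apply: risk_arithmetic => //; exact: D_ge0.
have risk0 : (0 <= risk)%E.
  apply: integral_ge0 => w _; apply: mule_ge0.
    by rewrite lee_fin invr_ge0 mulr_ge0.
  by apply: sume_ge0 => i _; apply: integral_ge0 => y _; rewrite lee_fin sqr_ge0.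
apply: le_ereal_inf_tmp => _ [V VVV <-].
set r := (_ + _) / _; set c := (5360 + _)^-1.
have risk_fin : risk \is a fin_num.
  by rewrite ge0_fin_numE// (le_lt_trans risk_triv)// ltry.
(* The distance to V is an infimum of square roots. y bounds every squared distance from below and
   is non-negative, so its root bounds the infimum and can be squared back. *)
pose y := Num.max (c * fine risk - r) 0.
have y0 : (0 <= y%:E)%E by rewrite lee_fin le_max lexx orbT.
have y_le (g : L2 (nu \x mu)%E mA) : V g ->
    (y%:E <= \int[(nu \x mu)%E]_(z in A) ((Num.sqrt (s z) - g z) ^+ 2)%:E)%E.
  move=> Vg; rewrite /y EFin_max ge_max; apply/andP; split; last first.
    by apply: integral_ge0 => z _; rewrite lee_fin sqr_ge0.
  rewrite EFinB leeBlDr// EFinM fineK// lee_pdivrMl//.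
  exact: main.
have sqrt_y : (sqrte y%:E <= L2dist_to (fun z => Num.sqrt (s z)) V)%E.
  apply: le_ereal_inf_tmp => _ [g Vg <-]; rewrite /L2dist lee_sqrt.
    exact: y_le.
  by apply: integral_ge0 => z _; rewrite lee_fin sqr_ge0.
apply: (@le_trans _ _ (y%:E + r%:E)%E).
  rewrite -[risk]fineK// -EFinM -EFinD lee_fin -lerBlDr.
  by rewrite le_max lexx.
apply: leeD => //; rewrite -[leLHS]sqr_sqrte// !expe2.
by apply: lee_pmul => //; exact: sqrte_ge0.
Qed.
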